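(* Let $\Lambda$ be a row-finite, source-free $k$-graph with finitely many vertices. Let $\Lambda_{\mathrm{ht}}$ be the Higman-Thompson like group of $\mathcal{O}_\Lambda$, and let $F(\mathcal{G}_\Lambda)$ be the group of full compact open bisections of the path groupoid $\mathcal{G}_\Lambda$. Then $\Lambda_{\mathrm{ht}}\cong F(\mathcal{G}_\Lambda)$ as groups.
   Context: **$k$-graphs.** $\mathbb{N}$ includes $0$ and $k\ge 1$. A $k$-graph is a countable small category $\Lambda$ with a functor $d:\Lambda\to\mathbb{N}^k$ such that whenever $d(\mu)=n+m$ there are unique $\alpha,\beta\in\Lambda$ with $\mu=\alpha\beta$, $d(\alpha)=n$, $d(\beta)=m$, $s(\alpha)=r(\beta)$ (products $\mu\nu$ are defined when $s(\mu)=r(\nu)$). $\Lambda^n:=d^{-1}(n)$; $\Lambda^0$ is the set of vertices; $v\Lambda^n:=\{\mu\in\Lambda^n: r(\mu)=v\}$. $\Lambda$ is row-finite if all $|v\Lambda^n|<\infty$, and source-free if all $v\Lambda^n\neq\varnothing$. **Infinite paths.** $\Omega_k:=\{(p,q)\in\mathbb{N}^k\times\mathbb{N}^k: p\le q\}$ is a $k$-graph with $(p,q)(q,m)=(p,m)$, $r(p,q)=(p,p)$, $s(p,q)=(q,q)$, $d(p,q)=q-p$. $\Lambda^\infty$ is the set of degree-preserving functors $x:\Omega_k\to\Lambda$; $v\Lambda^\infty:=\{x\in\Lambda^\infty:x(0,0)=v\}$. If $s(\mu)=x(0,0)$, $\mu x$ is the infinite path obtained by prefixing $\mu$ to $x$.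 $Z(\mu):=\{\mu x: x\in s(\mu)\Lambda^\infty\}$, and the sets $Z(\mu)$ form a basis of the topology of $\Lambda^\infty$ (which is compact Hausdorff when $\Lambda^0$ is finite). **The C*-algebra and $\Lambda_{\mathrm{ht}}$.** $\mathcal{O}_\Lambda$ is the universal C*-algebra generated by partial isometries $\{s_\mu\}_{\mu\in\Lambda}$ such that: $\{s_v\}_{v\in\Lambda^0}$ are mutually orthogonal projections; $s_{\mu\nu}=s_\mu s_\nu$ if $s(\mu)=r(\nu)$; $s_\mu^*s_\mu=s_{s(\mu)}$; $s_v=\sum_{\mu\in v\Lambda^n}s_\mu s_\mu^*$ for all $v\in\Lambda^0$, $n\in\mathbb{N}^k$. It is unital since $\Lambda^0$ is finite. $\Lambda_{\mathrm{ht}}$ is the set of all unitaries $U\in\mathcal{O}_\Lambda$ which can be written as a finite sum $U=\sum_{i=1}^n s_{\alpha_i}s_{\beta_i}^*$ with $\alpha_i,\beta_i\in\Lambda$, $s(\alpha_i)=s(\beta_i)$; it is a group under multiplication. **The groupoid.** $\mathcal{G}_\Lambda:=\{(\mu x,d(\mu)-d(\nu),\nu x)\in\Lambda^\infty\times\mathbb{Z}^k\times\Lambda^\infty: s(\mu)=s(\nu),\ x\in s(\mu)\Lambda^\infty\}$, with $r(x,n,y)=x$, $s(x,n,y)=y$, $(x,n,y)(y,m,z)=(x,n+m,z)$, $(x,n,y)^{-1}=(y,-n,x)$, unit space identified with $\Lambda^\infty$, and topology with basis the sets $Z(\mu,\nu):=\{(\mu x,d(\mu)-d(\nu),\nu x):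 x\in s(\mu)\Lambda^\infty\}$ with $s(\mu)=s(\nu)$. A bisection is a subset $U$ on which $r$ and $s$ are injective; it is full if $s(U)=r(U)=\Lambda^\infty$. $F(\mathcal{G}_\Lambda)$ is the set of full compact open bisections of $\mathcal{G}_\Lambda$, a group under the product $UV=\{\gamma\omega:\gamma\in U,\omega\in V, s(\gamma)=r(\omega)\}$. *)

(* Defs.v *)
From HB Require Import structures.
From mathcomp Require Import all_boot all_order all_algebra.
From mathcomp Require Import complex zify.
From mathcomp Require Import all_classical all_reals all_analysis.

Set Implicit Arguments.
Unset Strict Implicit.
Unset Printing Implicit Defensive.

Import Order.TTheory GRing.Theory Num.Theory.
Import numFieldNormedType.Exports.

Local Open Scope classical_set_scope.
Local Open Scope ring_scope.

Notation Nk k := {ffun 'I_k -> nat}.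
Notation Zk k := {ffun 'I_k -> int}.

Definition leNk k (p q : Nk k) : bool := [forall i, (p i <= q i)%N].
Definition subNk k (q p : Nk k) : Nk k := [ffun i => (q i - p i)%N].
Definition diffZk k (p q : Nk k) : Zk k := [ffun i => (p i)%:Z - (q i)%:Z].

(* A k-graph, as a category given by its set of morphisms: a vertex is        *)
(* identified with its identity morphism, so range and source are again       *)
(* morphisms.  kcomp is total, but its value is only constrained when         *)
(* ksrc mu = krng nu.                                                         *)
Record kgraph (k : nat) := KGraph {
  kmor :> countType;
  kdeg : kmor -> Nk k;
  krng : kmor -> kmor;
  ksrc : kmor -> kmor;
  kcomp : kmor -> kmor -> kmor;
  krng_rng : forall mu, krng (krng mu) = krng mu;
  ksrc_rng : forall mu, ksrc (krng mu) = krng mu;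
  krng_src : forall mu, krng (ksrc mu) = ksrc mu;
  ksrc_src : forall mu, ksrc (ksrc mu) = ksrc mu;
  krng_comp : forall mu nu, ksrc mu = krng nu ->
    krng (kcomp mu nu) = krng mu;
  ksrc_comp : forall mu nu, ksrc mu = krng nu ->
    ksrc (kcomp mu nu) = ksrc nu;
  kcompA : forall mu nu la, ksrc mu = krng nu -> ksrc nu = krng la ->
    kcomp mu (kcomp nu la) = kcomp (kcomp mu nu) la;
  kcomp_idl : forall mu, kcomp (krng mu) mu = mu;
  kcomp_idr : forall mu, kcomp mu (ksrc mu) = mu;
  kdeg_id : forall mu, kdeg (krng mu) = 0;
  kdeg_comp : forall mu nu, ksrc mu = krng nu ->
    kdeg (kcomp mu nu) = kdeg mu + kdeg nu;
  kfactor : forall mu (n m : Nk k), kdeg mu = n + m ->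
    exists! ab : kmor * kmor,
      [/\ mu = kcomp ab.1 ab.2, kdeg ab.1 = n, kdeg ab.2 = m
        & ksrc ab.1 = krng ab.2]
}.

Section KGraphTheory.
Context {k : nat}.
Implicit Types (L : kgraph k) (n p q : Nk k).

Definition kpaths L n : set L := [set mu | kdeg mu = n].
Definition kvertices L : set L := @kpaths L 0.
Definition kpaths_at L (v : L) n : set L :=
  [set mu | kpaths n mu /\ krng mu = v].

Definition row_finite L :=
  forall v n, kvertices v -> finite_set (@kpaths_at L v n).
Definition source_free L :=
  forall v n, kvertices v -> @kpaths_at L v n !=set0.

Lemma leNkP p q : reflect (exists n, q = p + n) (leNk p q).
Proof.
apply: (iffP forallP) => [pq|[n ->] i]; last by rewrite ffunE leq_addr.
by exists (subNk q p); apply/ffunP => i; rewrite !ffunE -[LHS](subnKC (pq i)).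
Qed.

Lemma leNk_add p n : leNk p (p + n).
Proof. by apply/leNkP; exists n. Qed.

Lemma addNkI n : injective (fun p : Nk k => n + p).
Proof.
move=> p q /ffunP e; apply/ffunP => i; have := e i.
by rewrite !ffunE => /addnI.
Qed.

Lemma subNkDl p n : subNk (p + n) p = n.
Proof. by apply/ffunP => i; rewrite !ffunE addKn. Qed.

Definition omega_mor : countType := {pq : Nk k * Nk k | leNk pq.1 pq.2}.

(* The morphism (p, q) of Omega_k, written with q = p + n. *)
Definition om p n : omega_mor := Sub (p, p + n) (leNk_add p n).

(* (p, q)(q, m) = (p, m); the default value is never used when a and b are    *)
(* composable.                                                                *)
Definition omega_comp (a b : omega_mor) : omega_mor :=
  insubd a ((val a).1, (val b).2).

Lemma omE (a : omega_mor) : a = om (val a).1 (subNk (val a).2 (val a).1).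
Proof.
apply: val_inj; case: a => -[p q] /= pq.
by case/leNkP: (pq) => n ->; rewrite subNkDl.
Qed.

Lemma om_inj p n p' n' : om p n = om p' n' -> p = p' /\ n = n'.
Proof. by move=> /(congr1 val) /= [<- /addNkI]. Qed.

Lemma omega_compE p n m : omega_comp (om p n) (om (p + n) m) = om p (n + m).
Proof.
apply: val_inj; rewrite /omega_comp val_insubd /=.
by rewrite -addrA leNk_add.
Qed.

Lemma om_src_rng p n p' : om (p + n) 0 = om p' 0 -> p' = p + n.
Proof. by case/om_inj. Qed.

Definition omega_kgraph : kgraph k.
Proof.
pose dg (a : omega_mor) := subNk (val a).2 (val a).1.
pose rg (a : omega_mor) := om (val a).1 0.
pose sr (a : omega_mor) := om (val a).2 0.
apply: (@KGraph k omega_mor dg rg sr omega_comp); rewrite /dg /rg /sr /=.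
- by [].
- by move=> a; rewrite addr0.
- by [].
- by move=> a; rewrite addr0.
- move=> a b; rewrite (omE a) (omE b) /= => /om_src_rng ->.
  by rewrite omega_compE.
- move=> a b; rewrite (omE a) (omE b) /= => /om_src_rng ->.
  by rewrite omega_compE /= addrA.
- move=> a b c; rewrite (omE a) (omE b) (omE c) /=.
  move: (subNk _ _) (subNk _ _) (subNk _ _) => n m l; move: (sval a).1 => p.
  move=> /om_src_rng -> /om_src_rng ->.
  by rewrite !omega_compE -[X in om X n]addrA omega_compE addrA.
- move=> a; rewrite [in RHS](omE a) {2}(omE a).
  by rewrite -[in X in omega_comp _ (om X _)](addr0 (val a).1) omega_compE add0r.
- move=> a; rewrite {1 2}(omE a) [in RHS](omE a).
  by rewrite /= omega_compE addr0.
- by move=> a; rewrite subNkDl.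
- move=> a b; rewrite (omE a) (omE b) /= => /om_src_rng ->.
  by rewrite omega_compE /= !subNkDl.
- move=> a n m; rewrite {1 2}(omE a) /= subNkDl => e.
  exists (om (val a).1 n, om ((val a).1 + n) m); split.
    by rewrite /= omega_compE !subNkDl (omE a) e.
  case=> b c /=; rewrite (omE b) (omE c) /= !subNkDl => -[ea <- <-].
  move=> /om_src_rng eb.
  move: ea; rewrite eb omega_compE => /(congr1 val) /= /(congr1 fst) /= ->.
  by [].
Defined.

(* Degree-preserving functors between k-graphs; identities are preserved      *)
(* because they are the ranges and sources.                                   *)
Definition kfunctor L1 L2 (f : L1 -> L2) :=
  [/\ forall mu, kdeg (f mu) = kdeg mu,
      forall mu, krng (f mu) = f (krng mu),
      forall mu, ksrc (f mu) = f (ksrc mu)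
    & forall mu nu, ksrc mu = krng nu -> f (kcomp mu nu) = kcomp (f mu) (f nu)].

Record infpath L := InfPath {
  infpath_fun :> omega_kgraph -> L;
  infpathP : kfunctor infpath_fun
}.

(* x(p, p + n) *)
Definition segment L (x : infpath L) p n : L := x (om p n).

Definition infpaths_at L (v : L) : set (infpath L) :=
  [set x | segment x 0 0 = v].

(* y = mu x: y is the path whose initial segment of degree d(mu) is mu and    *)
(* whose shift by d(mu) is x.                                                 *)
Definition prefixed L (mu : L) (x y : infpath L) :=
  [/\ infpaths_at (ksrc mu) x, segment y 0 (kdeg mu) = mu
    & forall p n, segment y (kdeg mu + p) n = segment x p n].

Definition in_path_groupoid L (g : infpath L * Zk k * infpath L) :=
  exists (mu nu : L) (x : infpath L), [/\ ksrc mu = ksrc nu,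
    prefixed mu x g.1.1, prefixed nu x g.2
    & g.1.2 = diffZk (kdeg mu) (kdeg nu)].

Record path_groupoid L := PathGroupoid {
  gpd_val : infpath L * Zk k * infpath L;
  gpd_valP : in_path_groupoid gpd_val
}.

Definition gpd_rng L (g : path_groupoid L) : infpath L := (gpd_val g).1.1.
Definition gpd_deg L (g : path_groupoid L) : Zk k := (gpd_val g).1.2.
Definition gpd_src L (g : path_groupoid L) : infpath L := (gpd_val g).2.

(* t = g h, for composable g and h *)
Definition gpd_mul L (g h t : path_groupoid L) :=
  gpd_src g = gpd_rng h /\
  gpd_val t = (gpd_rng g, gpd_deg g + gpd_deg h, gpd_src h).

Definition gpd_cylinder L (mu nu : L) : set (path_groupoid L) :=
  [set g | exists x, [/\ prefixed mu x (gpd_rng g), prefixed nu x (gpd_src g)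
                       & gpd_deg g = diffZk (kdeg mu) (kdeg nu)]].

Definition gpd_basis L : set (set (path_groupoid L)) :=
  [set gpd_cylinder mu.1 mu.2 | mu in [set mu : L * L | ksrc mu.1 = ksrc mu.2]].

Lemma segment_deg L (x : infpath L) p n : kdeg (segment x p n) = n.
Proof. by have [-> _ _ _] := infpathP x; rewrite /= subNkDl. Qed.

Lemma segment_rng L (x : infpath L) p n : krng (segment x p n) = segment x p 0.
Proof. by have [_ -> _ _] := infpathP x. Qed.

Lemma segment_src L (x : infpath L) p n :
  ksrc (segment x p n) = segment x (p + n) 0.
Proof. by have [_ _ -> _] := infpathP x. Qed.

Lemma segment_comp L (x : infpath L) p n m :
  segment x p (n + m) = kcomp (segment x p n) (segment x (p + n) m).
Proof. by have [_ _ _ <-] := infpathP x; rewrite //= omega_compE. Qed.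

Lemma segment_factor L (x y : infpath L) q n m :
  segment x q (n + m) = segment y q (n + m) ->
  segment x q n = segment y q n /\ segment x (q + n) m = segment y (q + n) m.
Proof.
move=> e; have [ab [_ uab]] := kfactor (segment_deg x q (n + m)).
have hx := uab (segment x q n, segment x (q + n) m).
have hy := uab (segment y q n, segment y (q + n) m).
suff : (segment x q n, segment x (q + n) m) =
       (segment y q n, segment y (q + n) m) by case=> -> ->.
rewrite -hx ?hy //; split; rewrite /= ?segment_deg ?segment_src ?segment_rng //.
  by rewrite e segment_comp.
by rewrite segment_comp.
Qed.

Lemma infpath_eq L (x y : infpath L) :
  (forall p n, segment x p n = segment y p n) -> x = y.
Proof.
case: x y => [x xP] [y yP] exy.
have {}exy : x = y by apply/funext => a; rewrite (omE a); exact: exy.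
by rewrite exy in xP *; congr InfPath; apply: Prop_irrelevance.
Qed.

Lemma infpath_eq0 L (x y : infpath L) :
  (forall n, segment x 0 n = segment y 0 n) -> x = y.
Proof.
move=> e; apply: infpath_eq => p n.
by have [_] := segment_factor (e (p + n)); rewrite add0r.
Qed.

Lemma prefixed_inj L (mu : L) x y z :
  prefixed mu x y -> prefixed mu x z -> y = z.
Proof.
move=> [_ y1 y2] [_ z1 z2]; apply: infpath_eq0 => n.
suff /segment_factor[] : segment y 0 (n + kdeg mu) = segment z 0 (n + kdeg mu).
  by [].
rewrite addrC !segment_comp y1 z1 add0r.
by have := y2 0 n; have := z2 0 n; rewrite addr0 => -> ->.
Qed.

Lemma shift_functor L (x : infpath L) p :
  kfunctor (fun a : omega_kgraph =>
    segment x (p + (val (a : omega_mor)).1) (kdeg a)).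
Proof.
split=> [a|a|a|a b].
- by rewrite segment_deg.
- by rewrite segment_rng /= subNkDl.
- rewrite segment_src /= subNkDl (omE a) /= subNkDl.
  by rewrite addrA.
- rewrite (omE a) (omE b) /= => /om_src_rng ->.
  by rewrite omega_compE /= !subNkDl segment_comp addrA.
Qed.

Definition shift L (x : infpath L) p : infpath L := InfPath (shift_functor x p).

Lemma segment_shift L (x : infpath L) p q n :
  segment (shift x p) q n = segment x (p + q) n.
Proof. by rewrite {1}/segment /= subNkDl. Qed.

Lemma prefixed_shift L (x : infpath L) p :
  prefixed (segment x 0 p) (shift x p) x.
Proof.
split=> [||q n]; rewrite ?segment_deg ?segment_shift //.
rewrite /infpaths_at /mkset segment_shift segment_src addr0 add0r //.
Qed.

Lemma prefixedP L (mu : L) x y :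
  prefixed mu x y <-> segment y 0 (kdeg mu) = mu /\ shift y (kdeg mu) = x.
Proof.
split=> [[_ e1 e2]|[e <-]]; last by rewrite -{1}e; exact: prefixed_shift.
by split=> //; apply: infpath_eq => p n; rewrite segment_shift e2.
Qed.

Lemma shiftD L (x : infpath L) p n : shift (shift x p) n = shift x (p + n).
Proof. by apply: infpath_eq => q m; rewrite !segment_shift addrA. Qed.

Lemma gpd_cylinder_sub L (mu nu : L) (g : path_groupoid L) n :
  gpd_cylinder mu nu g ->
  [/\ gpd_cylinder (segment (gpd_rng g) 0 (kdeg mu + n))
                   (segment (gpd_src g) 0 (kdeg nu + n)) g
    & gpd_cylinder (segment (gpd_rng g) 0 (kdeg mu + n))
                   (segment (gpd_src g) 0 (kdeg nu + n))
      `<=` gpd_cylinder mu nu].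
Proof.
set y := gpd_rng g; set z := gpd_src g.
have dE (p q : Nk k) : diffZk (p + n) (q + n) = diffZk p q.
  apply/ffunP => i; rewrite !ffunE !PoszD opprD addrACA subrr addr0.
  by [].
move=> [x [/prefixedP[y1 y2] /prefixedP[z1 z2] gE]]; split.
  exists (shift x n); split; last by rewrite !segment_deg dE.
  - by apply/prefixedP; rewrite segment_deg -y2 shiftD.
  - by apply/prefixedP; rewrite segment_deg -z2 shiftD.
move=> h [t [/prefixedP[+ +] /prefixedP[+ +]]].
rewrite !segment_deg dE => y3 y4 z3 z4 hE.
have [y5 y6] := segment_factor y3; have [z5 z6] := segment_factor z3.
exists (shift (gpd_rng h) (kdeg mu)); split=> //; apply/prefixedP; split=> //.
- by rewrite y5.
- by rewrite z5.
apply: (@prefixed_inj _ (segment x 0 n) t); apply/prefixedP.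
  rewrite segment_deg shiftD z4 segment_shift addr0 -z2 segment_shift addr0.
  by split=> //; move: z6; rewrite !add0r.
rewrite segment_deg shiftD y4 segment_shift addr0 -y2 segment_shift addr0.
by split=> //; move: y6; rewrite !add0r.
Qed.

Lemma gpd_cylinder_src L (mu nu : L) g n :
  gpd_cylinder mu nu g ->
  ksrc (segment (gpd_rng g) 0 (kdeg mu + n)) =
  ksrc (segment (gpd_src g) 0 (kdeg nu + n)).
Proof.
move=> [x [/prefixedP[_ y2] /prefixedP[_ z2] _]].
rewrite !segment_src !add0r.
have := congr1 (fun u => segment u n 0) y2.
have := congr1 (fun u => segment u n 0) z2.
by rewrite !segment_shift => -> ->.
Qed.

Lemma gpd_basis_cover L : \bigcup_(U in @gpd_basis L) U = setT.
Proof.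
rewrite predeqE => g; split=> // _.
have [mu [nu [x [e mux nux gE]]]] := gpd_valP g.
exists (gpd_cylinder mu nu); first by exists (mu, nu).
by exists x.
Qed.

Lemma gpd_basis_join L (U V : set (path_groupoid L)) g :
  gpd_basis U -> gpd_basis V -> U g -> V g ->
  exists W, [/\ gpd_basis W, W g & W `<=` U `&` V].
Proof.
move=> [[mu nu] /= _ <-] [[al be] /= _ <-] gU gV.
pose J : Nk k := [ffun i => maxn (kdeg mu i) (kdeg al i)].
pose n := subNk J (kdeg mu); pose m := subNk J (kdeg al).
have e1 : kdeg mu + n = kdeg al + m.
  apply/ffunP => i; rewrite !ffunE.
  exact: etrans (subnKC (leq_maxl _ _)) (esym (subnKC (leq_maxr _ _))).
have e2 : kdeg nu + n = kdeg be + m.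
  have [_ [_ _ h1]] := gU; have [_ [_ _ h2]] := gV.
  apply/ffunP => i; move/ffunP: e1 => /(_ i); move: h1; rewrite h2.
  move=> /ffunP /(_ i).
  have nE (a b : nat) : a + b = (a + b)%N by [].
  rewrite !ffunE !nE.
  by move: (kdeg mu i) (kdeg nu i) (kdeg al i) (kdeg be i) => a b c d; lia.
have [g1 s1] := gpd_cylinder_sub n gU; have [_ s2] := gpd_cylinder_sub m gV.
exists (gpd_cylinder (segment (gpd_rng g) 0 (kdeg mu + n))
                     (segment (gpd_src g) 0 (kdeg nu + n))); split=> //.
  exists (segment (gpd_rng g) 0 (kdeg mu + n),
          segment (gpd_src g) 0 (kdeg nu + n)) => //.
  exact: gpd_cylinder_src gU.
move=> h hW; split; first exact: s1.
by apply: s2; rewrite -e1 -e2.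
Qed.

HB.instance Definition _ L := gen_eqMixin (path_groupoid L).
HB.instance Definition _ L := gen_choiceMixin (path_groupoid L).
HB.instance Definition _ L := isBaseTopological.Build (path_groupoid L)
  (@gpd_basis_cover L) (@gpd_basis_join L).

Definition bisection L (U : set (path_groupoid L)) :=
  set_inj U (@gpd_rng L) /\ set_inj U (@gpd_src L).

Definition gpd_full L (U : set (path_groupoid L)) :=
  @gpd_src L @` U = setT /\ @gpd_rng L @` U = setT.

Definition full_bisections L : set (set (path_groupoid L)) :=
  [set U | [/\ bisection U, gpd_full U, compact U & open U]].

Definition bisection_mul L (U V : set (path_groupoid L)) :
  set (path_groupoid L) :=
  [set t | exists g h, [/\ U g, V h & gpd_mul g h t]].

End KGraphTheory.

(* A C*-algebra over the complex numbers R[i], not assumed to be unital.      *)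
(* The norm takes its values in the nonnegative reals inside R[i].            *)
Record cstarAlgebra (R : realType) := CStarAlgebra {
  csort :> completeNormedModType R[i];
  cmul : csort -> csort -> csort;
  cstar : csort -> csort;
  cmulA : forall a b c, cmul a (cmul b c) = cmul (cmul a b) c;
  cmulDl : forall a b c, cmul (a + b) c = cmul a c + cmul b c;
  cmulDr : forall a b c, cmul a (b + c) = cmul a b + cmul a c;
  cmulZl : forall z a b, cmul (z *: a) b = z *: cmul a b;
  cmulZr : forall z a b, cmul a (z *: b) = z *: cmul a b;
  cstarK : forall a, cstar (cstar a) = a;
  cstarD : forall a b, cstar (a + b) = cstar a + cstar b;
  cstarZ : forall z a, cstar (z *: a) = Num.conj z *: cstar a;
  cstarM : forall a b, cstar (cmul a b) = cmul (cstar b) (cstar a);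
  cnormM : forall a b, `|cmul a b| <= `|a| * `|b|;
  cnorm_star : forall a, `|cmul (cstar a) a| = `|a| ^+ 2
}.

Section CStar.
Context {R : realType}.
Implicit Types A B : cstarAlgebra R.

(* A need not have a unit, so unitarity says that U^*U and UU^* are the unit.  *)
Definition cidentity A (e : A) := forall a, cmul e a = a /\ cmul a e = a.

Definition cunitary A (U : A) :=
  cidentity (cmul (cstar U) U) /\ cidentity (cmul U (cstar U)).

Definition cprojection A (p : A) := cstar p = p /\ cmul p p = p.

Definition cpartial_isometry A (a : A) := cmul (cmul a (cstar a)) a = a.

Definition star_morphism A B (f : {linear A -> B}) :=
  (forall a b, f (cmul a b) = cmul (f a) (f b)) /\
  (forall a, f (cstar a) = cstar (f a)).

Definition closed_star_subalgebra A (S : set A) :=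
  [/\ closed S, S 0 /\ (forall z a b, S a -> S b -> S (z *: a + b)),
      forall a b, S a -> S b -> S (cmul a b)
    & forall a, S a -> S (cstar a)].

Definition cgenerated A (X : set A) :=
  forall S : set A, closed_star_subalgebra S -> X `<=` S -> S = setT.

Section CuntzKrieger.
Context {k : nat} (L : kgraph k).

Definition ck_family A (s : L -> A) :=
  (forall mu, cpartial_isometry (s mu)) /\
  [/\ forall v, kvertices v -> cprojection (s v) /\
        (forall w, kvertices w -> v <> w -> cmul (s v) (s w) = 0),
      forall mu nu, ksrc mu = krng nu ->
        s (kcomp mu nu) = cmul (s mu) (s nu),
      forall mu, cmul (cstar (s mu)) (s mu) = s (ksrc mu)
    & forall v n, kvertices v ->
        s v = \sum_(mu \in kpaths_at v n) cmul (s mu) (cstar (s mu))].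

(* (A, s) is the universal C*-algebra O_L generated by a Cuntz-Krieger        *)
(* family; it is determined up to isomorphism.                                *)
Definition universal_ck_family A (s : L -> A) :=
  [/\ ck_family s, cgenerated (range s)
    & forall B (t : L -> B), ck_family t ->
      exists2 f : {linear A -> B}, star_morphism f &
        forall mu, f (s mu) = t mu].

(* Meaningful when (A, s) is universal for L; the set is then Lambda_ht.       *)
Definition higman_thompson A (s : L -> A) : set A :=
  [set U | cunitary U /\
    exists (n : nat) (al be : 'I_n -> L),
      (forall i, ksrc (al i) = ksrc (be i)) /\
      U = \sum_(i < n) cmul (s (al i)) (cstar (s (be i)))].

End CuntzKrieger.
End CStar.

Definition is_group T (S : set T) (op : T -> T -> T) :=
  [/\ forall x y, S x -> S y -> S (op x y),
      forall x y z, S x -> S y -> S z -> op x (op y z) = op (op x y) z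
    & exists e, [/\ S e, forall x, S x -> op e x = x /\ op x e = x
      & forall x, S x -> exists2 y, S y & op x y = e /\ op y x = e]].

Definition group_isomorphic T1 (S1 : set T1) (op1 : T1 -> T1 -> T1)
    T2 (S2 : set T2) (op2 : T2 -> T2 -> T2) :=
  [/\ is_group S1 op1, is_group S2 op2
    & exists2 f : T1 -> T2, set_bij S1 S2 f &
      forall x y, S1 x -> S1 y -> f (op1 x y) = op2 (f x) (f y)].

(* Main.v *)
Require Import Defs.
From HB Require Import structures.
From mathcomp Require Import all_boot all_order all_algebra.
From mathcomp Require Import complex finmap ring zify.
From mathcomp.analysis.showcase Require Import summability.
From mathcomp Require Import all_classical all_reals all_analysis.
(* Once more, so that [kcomp] is the composition of a k-graph. *)
Require Import Defs.

(** The isomorphism sends [U = sum s_(a_i) s_(b_i)^*] to the union of the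
    cylinders [Z(a_i, b_i)]. Three facts make this work.

    First, [U] determines with which multiplicity each element of the groupoid
    is covered. Universality maps [O_L] to the bounded operators on the
    square-summable functions on pairs of an infinite path and a degree, where
    [s_mu] prepends [mu] to the path and adds its degree. There the matrix
    coefficients of [U] are these multiplicities ([spanval_delta], [act_perm]),
    and products are matrix products ([act_mul]).

    Second, the multiplicities determine [U] ([spanval_faithful]). The relation
    [s_v = sum s_c s_c^*] allows to extend all the [a_i] to one common degree;
    then distinct pairs have disjoint cylinders, which are nonempty since there
    are no sources, so each multiplicity is that of a single pair. The sums are
    closed under products ([spanval_mul]) because [s_b^* s_c = 0] for distinct
    paths [b], [c] of the same degree. This is the statement that projections
    adding up to a projection are orthogonal ([sum_projections_orthogonal]),
    which is derived from the C*-identity by elementary norm estimates.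

    Third, a unitary matrix whose coefficients are natural numbers is a
    permutation matrix ([cunitary_spanvalP]). So [U] is unitary exactly when
    its cylinders cover a full bisection once. Cylinders are compact and open
    ([gpd_cylinder_compact]), and a compact open set is a finite union of
    cylinders ([compact_open_pairs]), which gives all full compact open
    bisections ([full_bisection_pairs]). The matrix product is the product of
    bisections ([pairs_set_mul]), so the map is multiplicative, and the group
    structure is transported along it. *)

Set Implicit Arguments.
Unset Strict Implicit.
Unset Printing Implicit Defensive.

Import Order.TTheory GRing.Theory Num.Theory.
Import numFieldNormedType.Exports.

Local Open Scope classical_set_scope.
Local Open Scope ring_scope.

(** * Projections in a C*-algebra *)

Section CstarBasics.
Context {R : realType} {A : cstarAlgebra R}.
Implicit Types (a b q y : A) (p r : {poly R[i]}).

Lemma cmul0l a : cmul 0 a = 0.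
Proof. by have := cmulZl 0 (0 : A) a; rewrite !scale0r. Qed.

Lemma cmul0r a : cmul a 0 = 0.
Proof. by have := cmulZr 0 a (0 : A); rewrite !scale0r. Qed.

Lemma cmulNl a b : cmul (- a) b = - cmul a b.
Proof. by rewrite -scaleN1r cmulZl scaleN1r. Qed.

Lemma cmulNr a b : cmul a (- b) = - cmul a b.
Proof. by rewrite -scaleN1r cmulZr scaleN1r. Qed.

Lemma cmul_suml I (r : seq I) (P : pred I) (F : I -> A) b :
  cmul (\sum_(i <- r | P i) F i) b = \sum_(i <- r | P i) cmul (F i) b.
Proof.
by elim/big_rec2: _ => [|i x z _ <-]; rewrite ?cmul0l ?cmulDl.
Qed.

Lemma cmul_sumr I (r : seq I) (P : pred I) (F : I -> A) b :
  cmul b (\sum_(i <- r | P i) F i) = \sum_(i <- r | P i) cmul b (F i).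
Proof.
by elim/big_rec2: _ => [|i x z _ <-]; rewrite ?cmul0r ?cmulDr.
Qed.

Lemma cstar0 : cstar (0 : A) = 0.
Proof. by have := cstarZ 0 (0 : A); rewrite conjC0 !scale0r. Qed.

Lemma cstarN a : cstar (- a) = - cstar a.
Proof. by rewrite -scaleN1r cstarZ rmorphN1 scaleN1r. Qed.

Lemma cstar_sum I (r : seq I) (P : pred I) (F : I -> A) :
  cstar (\sum_(i <- r | P i) F i) = \sum_(i <- r | P i) cstar (F i).
Proof.
by elim/big_rec2: _ => [|i x z _ <-]; rewrite ?cstar0 ?cstarD.
Qed.

Lemma cnorm_star_eq0 a : cmul (cstar a) a = 0 -> a = 0.
Proof.
move=> a0; apply/eqP; rewrite -normr_eq0 -sqrf_eq0.
by rewrite -cnorm_star a0 normr0.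
Qed.

Lemma cprojection_norm q : cprojection q -> `|q| <= 1.
Proof.
move=> [qs qq]; have [->|q0] := eqVneq q 0; first by rewrite normr0 ler01.
rewrite -(@ler_pM2r _ `|q|) ?normr_gt0// mul1r -expr2 -cnorm_star qs qq.
by [].
Qed.

(** Evaluation of a polynomial at [y], the constants going to multiples of [q].
    When [q] is a unit for [y] this is multiplicative, so that norm estimates
    on combinations of powers of [q + z y] become identities between complex
    polynomials. *)
Definition corner_eval q y (p : {poly R[i]}) : A :=
  \sum_(i < size p) p`_i *: iter i (cmul y) q.

Section CornerEval.
Variables q y : A.
Hypotheses (qq : cmul q q = q) (qy : cmul q y = y) (yq : cmul y q = y).
Local Notation ev := (corner_eval q y).

Lemma corner_evalE n (p : {poly R[i]}) : (size p <= n)%N ->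
  ev p = \sum_(i < n) p`_i *: iter i (cmul y) q.
Proof.
move=> pn; rewrite /corner_eval.
rewrite (big_ord_widen _ (fun i => p`_i *: iter i (cmul y) q) pn) big_mkcond /=.
apply: eq_bigr => i _; case: ltnP => // le; by rewrite nth_default ?scale0r.
Qed.

Lemma corner_evalC c : ev c%:P = c *: q.
Proof.
rewrite (@corner_evalE 1) ?size_polyC ?leq_b1//.
by rewrite big_ord1 coefC.
Qed.

Lemma corner_evalD p r : ev (p + r) = ev p + ev r.
Proof.
rewrite (@corner_evalE (maxn (size p) (size r))) ?size_polyD//.
rewrite (@corner_evalE _ p (leq_maxl _ (size r))).
rewrite (@corner_evalE _ r (leq_maxr (size p) _)) -big_split.
by apply: eq_bigr => i _; rewrite coefD scalerDl.
Qed.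

Lemma corner_evalZ c p : ev (c *: p) = c *: ev p.
Proof.
rewrite (@corner_evalE (size p)) ?size_scale_leq// scaler_sumr.
by apply: eq_bigr => i _; rewrite coefZ scalerA.
Qed.

Lemma corner_evalXM p : ev ('X * p) = cmul y (ev p).
Proof.
rewrite mulrC (@corner_evalE (size p).+1); last first.
  by have [->|p0] := eqVneq p 0; rewrite ?mul0r ?size_poly0 ?size_mulX.
rewrite big_ord_recl coefMX scale0r add0r cmul_sumr; apply: eq_bigr => i _.
by rewrite coefMX /= cmulZr.
Qed.

Lemma corner_eval_comm p : cmul (ev p) y = cmul y (ev p).
Proof.
rewrite cmul_suml cmul_sumr; apply: eq_bigr => i _.
rewrite cmulZl cmulZr; congr (_ *: _).
by elim: (nat_of_ord i) => [|n IH] /=; rewrite ?qy ?yq // -cmulA IH.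
Qed.

Lemma corner_evalM p r : ev (p * r) = cmul (ev p) (ev r).
Proof.
elim/poly_ind: p r => [|p c IH] r.
  by rewrite mul0r -[0]/(0%:P) corner_evalC !scale0r cmul0l.
rewrite mulrDl -mulrA corner_evalD IH corner_evalXM cmulA corner_eval_comm.
rewrite mul_polyC corner_evalZ corner_evalD cmulDl.
rewrite [p * 'X]mulrC corner_evalXM corner_evalC; congr (_ + _).
rewrite cmulZl; congr (_ *: _); rewrite cmul_sumr; apply: eq_bigr => i _.
rewrite cmulZr; congr (_ *: _).
by case: (nat_of_ord i) => [|n] /=; rewrite ?qq// cmulA qy.
Qed.

Lemma corner_eval_linear c : ev (1 + c%:P * 'X) = q + c *: y.
Proof.
rewrite corner_evalD -[1]/(1%:P) corner_evalC scale1r; congr (_ + _).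
by rewrite mulrC corner_evalXM corner_evalC cmulZr yq.
Qed.

Lemma corner_eval_ballX p n : `|ev p| <= 1 -> `|ev (p ^+ n.+1)| <= 1.
Proof.
move=> p1; elim: n => [|n IH]; first by rewrite expr1.
rewrite exprS corner_evalM (le_trans (cnormM _ _))//.
by rewrite mulr_ile1.
Qed.

Lemma corner_eval_mean p r : `|ev p| <= 1 -> `|ev r| <= 1 ->
  `|ev (2^-1 *: (p + r))| <= 1.
Proof.
move=> p1 r1; rewrite corner_evalZ corner_evalD normrZ.
rewrite ger0_norm ?invr_ge0 ?ler0n// mulrC ler_pdivrMr ?ltr0n// mul1r.
by rewrite (le_trans (ler_normD _ _))// -[2]/(1 + 1) lerD.
Qed.

End CornerEval.

(** For [H = i sqrt 3], the numbers [(1 + H) / 2] and so on are sixth roots of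
    unity, and the right-hand side is twice the sum over the sixth roots of
    unity [w] of [(1 + Re w) (1 + w X) ^ 4]. The weight [1 + Re w] keeps the
    constant coefficient and half the linear one, and kills the others. *)
Lemma corner_quartic (S : comNzRingType) (X H z : S) : H ^+ 2 = - 3 -> 2 * z = 1 ->
  12 * (1 + 2 * X) = 4 * (1 + X) ^+ 4
    + (3 * ((z * (1 + X + (1 + H * X))) ^+ 4 + (z * (1 + X + (1 - H * X))) ^+ 4)
    + ((z * (1 - X + (1 + H * X))) ^+ 4 + (z * (1 - X + (1 - H * X))) ^+ 4)).
Proof.
move=> HH ez.
(* The cofactor of H ^ 2 + 3 is what remains when the right-hand side is
   divided by that polynomial. *)
transitivity (z ^+ 4 * (192 * (1 + 2 * X) + (H ^+ 2 + 3)
    * (192 * X ^+ 2 + 96 * X ^+ 3 + 8 * (H ^+ 2 + 3) * X ^+ 4))).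
  rewrite HH addNr !(mul0r, mulr0) addr0.
  transitivity ((2 * z) ^+ 4 * (12 * (1 + 2 * X))); last by ring.
  by rewrite ez expr1n mul1r.
transitivity ((2 * z) ^+ 4 * (4 * (1 + X) ^+ 4) + z ^+ 4 *
  (3 * ((2 + (1 + H) * X) ^+ 4 + (2 + (1 - H) * X) ^+ 4)
   + ((2 + (H - 1) * X) ^+ 4 + (2 - (H + 1) * X) ^+ 4))); first by ring.
by rewrite ez expr1n mul1r; ring.
Qed.

(** The estimate at [1 + y] and [1 - y] gives it at [1 + 3 y ^ 2], the mean of
    their cubes. As [y] is self-adjoint, [1 + i sqrt 3 y] has squared norm
    [|1 + 3 y ^ 2|], so it lies in the ball too, as does [1 - i sqrt 3 y]. The points
    [1 + w y] for [w] a sixth root of unity are [1 + y], [1 - y] and midpoints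
    of these four, and the mean of their fourth powers with the weights of
    [corner_quartic] is [1 + 2 y]. *)
Lemma corner_double q y : cprojection q -> cstar y = y ->
  cmul q y = y -> cmul y q = y ->
  `|q + y| <= 1 -> `|q - y| <= 1 -> `|q + 2 *: y| <= 1.
Proof.
move=> [qs qq] ys qy yq ball_p ball_m.
pose ev := corner_eval q y.
pose h : R[i] := 'i * sqrtC 3.
have hh : h ^+ 2 = - 3 by rewrite exprMn sqrCi sqrtCK mulN1r.
have hJ : Num.conj h = - h.
  by rewrite rmorphM /= conjCi (CrealP _) ?mulNr// ger0_real ?sqrtC_ge0 ?ler0n.
clearbody h.
pose H : {poly R[i]} := h%:P.
have HH : H ^+ 2 = - 3.
  by rewrite -rmorphXn hh rmorphN /= polyC_natr.
have halfE : 2 * (2^-1)%:P = 1 :> {poly R[i]}.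
  by rewrite -[2]/(2%:R) -polyC_natr -rmorphM /= divff ?pnatr_eq0.
have lin := corner_eval_linear yq.
have ball1 : `|ev (1 + 'X)| <= 1.
  by have := lin 1; rewrite polyC1 mul1r scale1r /ev => ->.
have ball2 : `|ev (1 - 'X)| <= 1.
  have := lin (-1); rewrite rmorphN /= polyC1 mulN1r scaleN1r /ev => ->.
  by [].
have ball3 : `|ev (1 + 3 * 'X ^+ 2)| <= 1.
  have -> : 1 + 3 * 'X ^+ 2 = 2^-1 *: ((1 + 'X) ^+ 3 + (1 - 'X) ^+ 3) :> {poly R[i]}.
    rewrite -mul_polyC; move: halfE; set z := (2^-1)%:P => ez.
    by transitivity (2 * z * (1 + 3 * 'X ^+ 2)); [rewrite ez mul1r | ring].
  by apply: corner_eval_mean; apply: corner_eval_ballX.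
have ballH c : c ^+ 2 = - 3 -> Num.conj c = - c -> `|ev (1 + c%:P * 'X)| <= 1.
  move=> cc cJ; have CC : c%:P ^+ 2 = - 3 :> {poly R[i]}.
    by rewrite -rmorphXn cc rmorphN /= polyC_natr.
  rewrite -(@ler_pXn2r _ 2) ?nnegrE ?normr_ge0 ?ler01// expr1n -cnorm_star.
  rewrite /ev lin cstarD cstarZ qs ys cJ -!lin -corner_evalM//.
  suff -> : (1 + (- c)%:P * 'X) * (1 + c%:P * 'X) = 1 + 3 * 'X ^+ 2 by [].
  rewrite rmorphN /=; transitivity (1 - c%:P ^+ 2 * 'X ^+ 2); first by ring.
  by rewrite CC; ring.
have ballHp : `|ev (1 + H * 'X)| <= 1 by exact: ballH.
have ballHm : `|ev (1 - H * 'X)| <= 1.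
  have : `|ev (1 + (- h)%:P * 'X)| <= 1.
    by apply: ballH; rewrite ?sqrrN ?[Num.conj _]rmorphN /= ?hJ.
  by rewrite rmorphN /= -/H mulNr.
pose p (u v : {poly R[i]}) := 2^-1 *: (u + v).
have ball4 u v : `|ev u| <= 1 -> `|ev v| <= 1 -> `|ev (p u v ^+ 4)| <= 1.
  by move=> u1 v1; apply: corner_eval_ballX => //; apply: corner_eval_mean.
have ball5 : `|ev ((1 + 'X) ^+ 4)| <= 1 by apply: corner_eval_ballX.
have key : 12 *: (1 + 2%:P * 'X) = 4 *: (1 + 'X) ^+ 4
    + (3 *: (p (1 + 'X) (1 + H * 'X) ^+ 4 + p (1 + 'X) (1 - H * 'X) ^+ 4)
    + (p (1 - 'X) (1 + H * 'X) ^+ 4 + p (1 - 'X) (1 - H * 'X) ^+ 4)) :> {poly R[i]}.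
  rewrite /p -!mul_polyC !polyC_natr.
  exact: corner_quartic.
rewrite -(lin 2) -/ev -(@ler_pM2l _ 12) ?ltr0n// mulr1.
have -> : 12 * `|ev (1 + 2%:P * 'X)| = `|ev (12 *: (1 + 2%:P * 'X))|.
  by rewrite /ev corner_evalZ normrZ ger0_norm ?ler0n.
rewrite key /ev !corner_evalD !corner_evalZ !corner_evalD -/ev.
have nZ (n : nat) a c : `|a| <= c -> `|n%:R *: a| <= n%:R * c.
  by move=> ac; rewrite normrZ ger0_norm ?ler0n// ler_wpM2l ?ler0n.
have nD a b c d : `|a| <= c -> `|b| <= d -> `|a + b| <= c + d.
  by move=> ac bd; rewrite (le_trans (ler_normD _ _))// lerD.
apply: le_trans (nD _ _ _ _ (nZ 4%N _ _ ball5) (nD _ _ _ _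
  (nZ 3%N _ _ (nD _ _ _ _ (ball4 _ _ ball1 ballHp) (ball4 _ _ ball1 ballHm)))
  (nD _ _ _ _ (ball4 _ _ ball2 ballHp) (ball4 _ _ ball2 ballHm)))) _.
by rewrite le_eqVlt; apply/orP; left; apply/eqP; ring.
Qed.

(** By [corner_double] the hypotheses on [y] pass to [2 y], hence to all
    [2 ^ n y], whose norms are then bounded by 1. This replaces the spectral
    argument that the spectrum of [y] lies both in the nonnegative and in the
    nonpositive reals. *)
Lemma corner_extreme q y : cprojection q -> cstar y = y ->
  cmul q y = y -> cmul y q = y ->
  `|q + y| <= 1 -> `|q - y| <= 1 -> y = 0.
Proof.
move=> pq ys qy yq ball_p ball_m.
have ball n : `|q + (2 ^+ n) *: y| <= 1 /\ `|q - (2 ^+ n) *: y| <= 1.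
  elim: n => [|n [IHp IHm]]; first by rewrite !scale1r.
  have real2 : Num.conj (2 ^+ n : R[i]) = 2 ^+ n.
    by rewrite rmorphXn /= conjC_nat.
  rewrite exprS -!scalerA -scalerN; split; apply: corner_double => //.
  - by rewrite cstarZ ys real2.
  - by rewrite cmulZr qy.
  - by rewrite cmulZl yq.
  - by rewrite cstarN cstarZ ys real2.
  - by rewrite cmulNr cmulZr qy.
  - by rewrite cmulNl cmulZl yq.
  - by rewrite opprK.
have {}ball n : 2 ^+ n * `|y| <= 1.
  have [bp bm] := ball n.
  rewrite -(@ler_pM2l _ 2) ?ltr0n// mulr1.
  have -> : 2 * (2 ^+ n * `|y|) = `|(q + (2 ^+ n) *: y) - (q - (2 ^+ n) *: y)|.
    set z := _ *: y; rewrite opprB addrC addrA subrK -mulr2n -(scaler_nat 2 z).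
    by rewrite !normrZ (ger0_norm (ler0n _ _)) ger0_norm ?exprn_ge0 ?ler0n.
  by rewrite (le_trans (ler_normB _ _))// -[2]/(1 + 1) lerD.
apply/eqP; rewrite -normr_eq0; apply/negPn/negP => y0.
have [r ry] : exists r : R, `|y| = r%:C%C.
  by apply/complex_realP; rewrite ger0_real.
have r0 : 0 < r by rewrite -ltcR -ry lt_def y0 normr_ge0.
pose n := Num.Def.archi_bound r^-1.
have := ball n; rewrite ry -[2]/(1 + 1) -(rmorph1 (real_complex R)) -rmorphD.
rewrite -rmorphXn -rmorphM lecR leNgt => /negP; apply.
rewrite -ltr_pdivrMr// mul1r.
apply: lt_trans (archi_boundP _) _; first by rewrite invr_ge0 ltW.
by rewrite -[1 + 1]/(2%:R) -natrX ltr_nat ltn_expl.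
Qed.

(** The compressions [q x q] of the other terms [x] add up to 0. Each of them
    is within distance 1 of [q], so both [n q + q r q] and [n q - q r q] have
    norm at most [n], where [n] counts those terms. As [q] is extreme in the
    ball of its corner, [q r q = 0], that is [(r q)^* (r q) = 0]. *)
Lemma sum_projections_orthogonal (p q r : A) (t : seq A) :
  (forall x, x \in [:: q, r & t] -> cprojection x /\ cmul p x = x) ->
  cprojection p -> \sum_(x <- [:: q, r & t]) x = p -> cmul q r = 0.
Proof.
move=> Pt [ps pp] sump.
have [[qs qq] pq] : cprojection q /\ cmul p q = q by apply: Pt; rewrite !inE eqxx.
have [[rs rr] pr] : cprojection r /\ cmul p r = r.
  by apply: Pt; rewrite !inE eqxx orbT.
have qp : cmul q p = q by rewrite -qs -{1}ps -cstarM pq.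
pose c x := cmul (cmul q x) q.
have cq x : cmul q (c x) = c x by rewrite /c !cmulA qq.
have qc x : cmul (c x) q = c x by rewrite /c -!cmulA qq.
have cs x : cprojection x -> cstar (c x) = c x.
  by move=> [xs _]; rewrite /c !cstarM qs xs cmulA.
have q1 : `|q| <= 1 by exact: cprojection_norm.
have near1 x : x \in [:: q, r & t] -> `|q - c x| <= 1.
  move=> /Pt[[xs xx] px].
  have xp : cmul x p = x by rewrite -xs -{1}ps -cstarM px.
  have -> : q - c x = cmul (cmul q (p - x)) q.
    by rewrite cmulDr cmulNr qp cmulDl cmulNl qq.
  have px1 : `|p - x| <= 1.
    apply: cprojection_norm; split; first by rewrite cstarD cstarN ps xs.
    by rewrite cmulDl !cmulDr !cmulNl !cmulNr pp px xp xx opprK addNr addr0.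
  rewrite (le_trans (cnormM _ _))// mulr_ile1//.
  by rewrite (le_trans (cnormM _ _))// mulr_ile1.
have sumc : \sum_(x <- t) c x = - c r.
  have : c p = q by rewrite /c qp qq.
  rewrite -sump /c cmul_sumr cmul_suml !big_cons -/(c q) -/(c r) {1}/c !qq.
  by move=> /(canRL (addKr _)); rewrite addNr => /eqP; rewrite addrC addr_eq0 => /eqP.
pose m : R[i] := (size t).+1%:R.
have m0 : 0 < m by rewrite ltr0n.
have mE : m *: q = q + \sum_(x <- t) q.
  by rewrite big_const_seq count_predT iter_addr_0 /m mulrS scalerDl scale1r scaler_nat.
have inv_ball z : `|m *: q + z| <= m -> `|q + m^-1 *: z| <= 1.
  move=> mz; rewrite -(ler_pM2l m0) mulr1.
  by rewrite -{1}(gtr0_norm m0) -normrZ scalerDr scalerA divff ?scale1r ?gt_eqF.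
have sumt (s : seq A) : {subset s <= [:: q, r & t]} ->
    `|\sum_(x <- s) (q - c x)| <= (size s)%:R.
  elim: s => [|x s IH] sub; first by rewrite big_nil normr0.
  rewrite big_cons /= mulrS (le_trans (ler_normD _ _))// lerD//.
    by apply/near1/sub; rewrite inE eqxx.
  by apply: IH => z zs; apply: sub; rewrite inE zs orbT.
have cr0 : c r = 0.
  have : m^-1 *: c r = 0.
    apply: (@corner_extreme q) => //.
    - by rewrite cstarZ cs// (CrealP _) ?realV ?gtr0_real.
    - by rewrite cmulZr cq.
    - by rewrite cmulZl qc.
    - apply: inv_ball.
      have -> : m *: q + c r = q + \sum_(x <- t) (q - c x).
        by rewrite sumrB sumc opprK mE addrA.
      rewrite (le_trans (ler_normD _ _))// /m mulrS lerD// sumt//.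
      by move=> x xt; rewrite !inE xt !orbT.
    - rewrite -scalerN; apply: inv_ball.
      have -> : m *: q - c r = (q - c r) + \sum_(x <- t) q by rewrite mE addrAC.
      rewrite (le_trans (ler_normD _ _))// /m mulrS lerD ?near1 ?inE ?eqxx ?orbT//.
      rewrite big_const_seq count_predT iter_addr_0.
      by rewrite normrMn -mulr_natl ler_piMr.
  by move/eqP; rewrite scaler_eq0 invr_eq0 gt_eqF//= => /eqP.
have rq0 : cmul r q = 0.
  apply: cnorm_star_eq0.
  by rewrite cstarM qs rs cmulA -[cmul (cmul q r) r]cmulA rr.
by rewrite -[cmul q r]cstarK cstarM qs rs rq0 cstar0.
Qed.

End CstarBasics.

(** * Bounded operators on a Hilbert space *)

(** Completeness is asked of Cauchy filters for the norm that the inner product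
    defines, without a choice of topology on the carrier. *)
Record hilbertSpace (R : realType) := HilbertSpace {
  hilbert_sort :> lmodType R[i];
  inner : hilbert_sort -> hilbert_sort -> R[i];
  innerDl : forall x y z, inner (x + y) z = inner x z + inner y z;
  innerZl : forall a x y, inner (a *: x) y = a * inner x y;
  innerC : forall x y, inner x y = Num.conj (inner y x);
  inner_ge0 : forall x, 0 <= inner x x;
  inner_eq0 : forall x, inner x x = 0 -> x = 0;
  hilbert_complete : forall F : set_system hilbert_sort, ProperFilter F ->
    (forall e : R[i], 0 < e ->
      exists x, F [set y | sqrtC (inner (y - x) (y - x)) <= e]) ->
    exists x, forall e : R[i], 0 < e ->
      F [set y | sqrtC (inner (y - x) (y - x)) <= e]
}.

Section HilbertNorm.
Context {R : realType} {H : hilbertSpace R}.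
Implicit Types (x y z : H) (a : R[i]).

Lemma innerDr x y z : inner x (y + z) = inner x y + inner x z.
Proof. by rewrite innerC innerDl rmorphD /= -!innerC. Qed.

Lemma innerZr a x y : inner x (a *: y) = Num.conj a * inner x y.
Proof. by rewrite innerC innerZl rmorphM /= -innerC. Qed.

Lemma inner0l x : inner 0 x = 0.
Proof. by rewrite -(scale0r 0) innerZl mul0r. Qed.

Lemma inner0r x : inner x 0 = 0.
Proof. by rewrite innerC inner0l conjC0. Qed.

Lemma innerNl x y : inner (- x) y = - inner x y.
Proof. by rewrite -scaleN1r innerZl mulN1r. Qed.

Lemma innerNr x y : inner x (- y) = - inner x y.
Proof. by rewrite innerC innerNl rmorphN /= -innerC. Qed.

Lemma inner_ext x y : (forall z, inner x z = inner y z) -> x = y.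
Proof.
move=> e; apply/eqP; rewrite -subr_eq0; apply/eqP/inner_eq0.
by rewrite innerDl innerNl e subrr.
Qed.

Definition hnorm x : R[i] := sqrtC (inner x x).

Lemma hnorm_ge0 x : 0 <= hnorm x.
Proof. by rewrite sqrtC_ge0 inner_ge0. Qed.

Lemma hnorm_sqr x : hnorm x ^+ 2 = inner x x.
Proof. by rewrite sqrtCK. Qed.

Lemma hnorm_eq0 x : hnorm x = 0 -> x = 0.
Proof. by move/eqP; rewrite sqrtC_eq0 => /eqP /inner_eq0. Qed.

Lemma hnorm0 : hnorm 0 = 0.
Proof. by rewrite /hnorm inner0l sqrtC0. Qed.

Lemma hnormZ a x : hnorm (a *: x) = `|a| * hnorm x.
Proof.
rewrite /hnorm innerZl innerZr mulrA -normCK sqrtCM ?nnegrE ?exprn_ge0//.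
  by rewrite sqrCK.
exact: inner_ge0.
Qed.

Lemma hnormN x : hnorm (- x) = hnorm x.
Proof. by rewrite -scaleN1r hnormZ normrN1 mul1r. Qed.

Lemma inner_le_hnorm x y : `|inner x y| <= hnorm x * hnorm y.
Proof.
have [->|y0] := eqVneq y 0.
  by rewrite inner0r normr0 mulr_ge0 ?hnorm_ge0.
have yy : 0 < inner y y.
  by rewrite lt_def inner_ge0 andbT; apply: contra_neq y0 => /inner_eq0.
have yJ : Num.conj (inner y y) = inner y y by rewrite -innerC.
rewrite -(@ler_pXn2r _ 2) ?nnegrE ?mulr_ge0 ?hnorm_ge0// exprMn !hnorm_sqr.
pose z := inner y y *: x - inner x y *: y.
have : 0 <= inner z z by exact: inner_ge0.
rewrite /z !(innerDl, innerDr, innerNl, innerNr, innerZl, innerZr) yJ.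
rewrite (innerC y x) normCK -subr_ge0.
set a := inner x y; set X := inner x x; set Y := inner y y => z0.
rewrite -(pmulr_rge0 _ yy) -/Y; apply: le_trans z0 _.
by rewrite le_eqVlt; apply/orP; left; apply/eqP; ring.
Qed.

Lemma hnormD x y : hnorm (x + y) <= hnorm x + hnorm y.
Proof.
rewrite -(@ler_pXn2r _ 2) ?nnegrE ?addr_ge0 ?hnorm_ge0//.
rewrite sqrrD !hnorm_sqr innerDl !innerDr (innerC y x).
have cross : inner x y + Num.conj (inner x y) <= hnorm x * hnorm y *+ 2.
  apply: le_trans (real_ler_norm _) _.
    by apply/CrealP; rewrite rmorphD /= conjCK addrC.
  rewrite (le_trans (ler_normD _ _))// norm_conjC -mulr2n lerMn2r /=.
  exact: inner_le_hnorm.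
by rewrite -!addrA lerD2l [leLHS]addrA [leRHS]addrA lerD2r.
Qed.

Lemma hnormB x y : hnorm (x - y) <= hnorm x + hnorm y.
Proof. by rewrite -(hnormN y) hnormD. Qed.

End HilbertNorm.

Section BoundedOperators.
Context {R : realType} (H : hilbertSpace R).
Implicit Types (T S : H -> H) (x y z : H).

Definition adjoint_to T S := forall x y, inner (T x) y = inner x (S y).

Definition bounded_by T (M : R) := forall x, hnorm (T x) <= M%:C%C * hnorm x.

(** Operators are mere functions: having an adjoint makes them linear. *)
Definition adjointable : {pred H -> H} :=
  [pred T | `[< (exists S, adjoint_to T S) /\ exists M, bounded_by T M >]].

Lemma adjointableP T :
  reflect ((exists S, adjoint_to T S) /\ exists M, bounded_by T M)
          (T \in adjointable).
Proof. exact: asboolP. Qed.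

Lemma adjointable_submod : submod_closed adjointable.
Proof.
split=> [|a T S /adjointableP[[T' TT'] [M TM]] /adjointableP[[S' SS'] [N SN]]].
  apply/adjointableP; split; first by exists 0 => x y; rewrite inner0l inner0r.
  by exists 0 => x; rewrite hnorm0 mul0r.
apply/adjointableP; split.
  exists (Num.conj a *: T' + S') => x y.
  by rewrite innerDl innerZl innerDr innerZr conjCK TT' SS'.
exists (complex.Re `|a| * M + N) => x.
rewrite (le_trans (hnormD _ _))// hnormZ rmorphD rmorphM /= mulrDl lerD//.
by rewrite -mulrA; apply: (@ler_wpM2l _ `|a|).
Qed.

HB.instance Definition _ :=
  GRing.isSubmodClosed.Build _ _ adjointable adjointable_submod.

Record bounded_op := BoundedOp {
  bounded_op_val :> H -> H;
  _ : bounded_op_val \in adjointable }.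

HB.instance Definition _ := [isSub for bounded_op_val].
HB.instance Definition _ := [Choice of bounded_op by <:].
HB.instance Definition _ := [SubChoice_isSubLmodule of bounded_op by <:].

Implicit Types A B : bounded_op.

Lemma bounded_opP A :
  (exists S, adjoint_to A S) /\ exists M, bounded_by A M.
Proof. by case: A => T TP; apply/adjointableP. Qed.

Lemma bounded_op_ext A B : (forall x, A x = B x) -> A = B.
Proof. by move=> e; apply/val_inj/funext. Qed.

Definition opnorm T : R := inf [set M | 0 <= M /\ bounded_by T M].

Lemma opnorm_ge0 T : 0 <= opnorm T.
Proof.
rewrite /opnorm; set X := [set M | _].
have [->|/set0P ne] := eqVneq X set0; first by rewrite inf0.
by apply: lb_le_inf => // M [].
Qed.

Lemma opnorm_le T (M : R) : 0 <= M -> bounded_by T M -> opnorm T <= M.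
Proof. by move=> M0 TM; apply: ge_inf => //; exists 0 => N []. Qed.

Lemma le_opnorm A x : hnorm (A x) <= (opnorm A)%:C%C * hnorm x.
Proof.
have [_ [M AM]] := bounded_opP A.
have [/eqP x0|x0] := eqVneq (hnorm x) 0.
  by have := AM x; rewrite (eqP x0) !mulr0.
have {}x0 : 0 < hnorm x by rewrite lt_def x0 hnorm_ge0.
have [r rx] : exists r : R, hnorm (A x) / hnorm x = r%:C%C.
  by apply/complex_realP; rewrite ger0_real// divr_ge0 ?hnorm_ge0.
rewrite -ler_pdivrMr// rx lecR.
apply: lb_le_inf => [|N [N0 AN]]; last by rewrite -lecR -rx ler_pdivrMr.
exists `|M|; split=> [|y]; first exact: normr_ge0.
by rewrite (le_trans (AM y))// ler_wpM2r ?hnorm_ge0// lecR ler_norm.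
Qed.

Lemma opnorm0_eq0 A : opnorm A = 0 -> A = 0.
Proof.
move=> A0; apply: bounded_op_ext => x; apply: hnorm_eq0.
by apply/le_anti; rewrite hnorm_ge0 -(mul0r (hnorm x)) -[0]/(0%:C%C) -A0 le_opnorm.
Qed.

Lemma opnormD A B : (opnorm (A + B))%:C%C <= (opnorm A)%:C%C + (opnorm B)%:C%C.
Proof.
rewrite -rmorphD lecR; apply: opnorm_le => [|x].
  by rewrite addr_ge0 ?opnorm_ge0.
by rewrite (le_trans (hnormD _ _))// rmorphD mulrDl lerD ?le_opnorm.
Qed.

Lemma opnormZ_le (a : R[i]) A : (opnorm (a *: A))%:C%C <= `|a| * (opnorm A)%:C%C.
Proof.
rewrite -[Num.norm a]/((Normc.normc a)%:C%C) -rmorphM lecR; apply: opnorm_le => [|x].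
  by rewrite mulr_ge0 ?opnorm_ge0// -ler0c; apply: (@normr_ge0 _ _ a).
rewrite hnormZ rmorphM -mulrA; apply: (@ler_wpM2l _ `|a|) => //.
exact: le_opnorm.
Qed.

Lemma opnormZ (a : R[i]) A : (opnorm (a *: A))%:C%C = `|a| * (opnorm A)%:C%C.
Proof.
apply/le_anti; rewrite opnormZ_le /=; have [->|a0] := eqVneq a 0.
  by rewrite normr0 mul0r ler0c opnorm_ge0.
rewrite -ler_pdivlMl ?normr_gt0// -normfV.
by have := opnormZ_le a^-1 (a *: A); rewrite scalerA mulVf// scale1r.
Qed.

HB.instance Definition _ := Lmodule_isNormed.Build R[i] bounded_op
  opnormD opnormZ (fun A e => opnorm0_eq0 (complexI e)).

Lemma le_bop_norm A x : hnorm (A x) <= `|A| * hnorm x.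
Proof. exact: le_opnorm. Qed.

Lemma bop_norm_le A (e : R[i]) : 0 <= e ->
  (forall x, hnorm (A x) <= e * hnorm x) -> `|A| <= e.
Proof.
move=> e0 Ae; have /complex_realP[r er] : e \is Num.real by rewrite ger0_real.
move: e0 Ae; rewrite er => e0 Ae.
by rewrite lecR; apply: opnorm_le => //; rewrite -ler0c.
Qed.

Lemma bop_lin A (a : R[i]) x y : A (a *: x + y) = a *: A x + A y.
Proof.
have [[S AS] _] := bounded_opP A; apply: inner_ext => z.
by rewrite innerDl innerZl !AS innerDl innerZl.
Qed.

Lemma bopB A x y : A (x - y) = A x - A y.
Proof. by rewrite addrC -scaleN1r bop_lin scaleN1r addrC. Qed.

Lemma adjoint_to_sym T S : adjoint_to T S -> adjoint_to S T.
Proof. by move=> TS x y; rewrite innerC -TS -innerC. Qed.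

Lemma adjoint_bound A S : adjoint_to A S -> forall x, hnorm (S x) <= `|A| * hnorm x.
Proof.
move=> AS x; have [/eqP Sx0|Sx0] := eqVneq (hnorm (S x)) 0.
  by rewrite (eqP Sx0) mulr_ge0 ?hnorm_ge0.
have {}Sx0 : 0 < hnorm (S x) by rewrite lt_def Sx0 hnorm_ge0.
rewrite -(ler_pM2r Sx0) -expr2 hnorm_sqr -AS.
rewrite -[leLHS]ger0_norm; last by rewrite AS inner_ge0.
rewrite (le_trans (inner_le_hnorm _ _))// mulrAC.
by rewrite ler_wpM2r ?hnorm_ge0 ?le_bop_norm.
Qed.

Fact bounded_comp A B : (fun x => A (B x)) \in adjointable.
Proof.
have [[S AS] _] := bounded_opP A; have [[T BT] _] := bounded_opP B.
apply/adjointableP; split; first by exists (fun x => T (S x)) => x y; rewrite AS BT.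
exists (opnorm A * opnorm B) => x; rewrite rmorphM -mulrA.
rewrite (le_trans (le_opnorm A _))// ler_wpM2l ?ler0c ?opnorm_ge0//.
exact: le_opnorm.
Qed.

Definition bop_mul A B := BoundedOp (bounded_comp A B).

Fact bounded_adjoint A : exists B, adjoint_to A B.
Proof.
have [[S AS] _] := bounded_opP A.
suff SP : S \in adjointable by exists (BoundedOp SP).
apply/adjointableP; split; first by exists A; apply: adjoint_to_sym.
by exists (opnorm A); apply: adjoint_bound.
Qed.

Definition bop_star A : bounded_op := sval (cid (bounded_adjoint A)).

Lemma bop_starP A : adjoint_to A (bop_star A).
Proof. by rewrite /bop_star; case: cid. Qed.

Lemma bop_star_eq A B : adjoint_to A B -> bop_star A = B.
Proof.
move=> AB; apply: bounded_op_ext => x; apply: inner_ext => z.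
by rewrite innerC -bop_starP AB -innerC.
Qed.

Lemma bop_starD A B : bop_star (A + B) = bop_star A + bop_star B.
Proof.
by apply: bop_star_eq => x y; rewrite innerDl innerDr !bop_starP.
Qed.

Lemma bop_starZ (a : R[i]) A : bop_star (a *: A) = Num.conj a *: bop_star A.
Proof.
by apply: bop_star_eq => x y; rewrite innerZl innerZr conjCK bop_starP.
Qed.

Lemma bop_starN A : bop_star (- A) = - bop_star A.
Proof. by apply: bop_star_eq => x y; rewrite innerNl innerNr bop_starP. Qed.

Lemma bop_norm_mul A B : `|bop_mul A B| <= `|A| * `|B|.
Proof.
apply: bop_norm_le => [|x]; first by rewrite mulr_ge0.
by rewrite (le_trans (le_bop_norm A _))// -mulrA ler_wpM2l ?le_bop_norm.
Qed.

Lemma bop_norm_star_le A : `|bop_star A| <= `|A|.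
Proof. by apply: bop_norm_le => //; apply: adjoint_bound (bop_starP A). Qed.

Lemma bop_norm_star A : `|bop_mul (bop_star A) A| = `|A| ^+ 2.
Proof.
apply/le_anti; rewrite (le_trans (bop_norm_mul _ _)) /=; last first.
  by rewrite expr2 ler_wpM2r// bop_norm_star_le.
set N := `|bop_mul _ _|; rewrite -(sqrtCK N).
have N0 : 0 <= sqrtC N by rewrite sqrtC_ge0 normr_ge0.
rewrite ler_pXn2r ?nnegrE//; apply: bop_norm_le => // x.
rewrite -(@ler_pXn2r _ 2) ?nnegrE ?mulr_ge0 ?hnorm_ge0//.
rewrite exprMn (sqrtCK N) (hnorm_sqr (A x)) -[leLHS]ger0_norm ?inner_ge0//.
rewrite bop_starP innerC norm_conjC (le_trans (inner_le_hnorm _ _))// expr2 mulrA.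
by rewrite ler_wpM2r ?hnorm_ge0// (le_bop_norm (bop_mul (bop_star A) A)).
Qed.

(** Completeness of the space gives the limit at each vector; letting one of
    two nearby operators tend to it makes the convergence uniform on the unit
    ball. The map [f] allows to use this for the adjoints as well. *)
Lemma cauchy_pointwise (F : set_system bounded_op) (f : bounded_op -> bounded_op) :
  ProperFilter F ->
  (forall e : R[i], 0 < e -> exists A, F [set B | `|f B - f A| <= e]) ->
  exists T : H -> H, forall e : R[i], 0 < e ->
    F [set B | forall x, hnorm (f B x - T x) <= e * hnorm x].
Proof.
move=> FF Fc.
have lim x : exists y, forall e : R[i], 0 < e -> F [set B | hnorm (f B x - y) <= e].
  have GF := fmap_proper_filter (fun B => f B x) FF.
  apply: (@hilbert_complete R H _ GF) => e e0.
  have n0 : 0 < hnorm x + 1 by rewrite ltr_wpDl ?hnorm_ge0.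
  have [A FA] := Fc _ (divr_gt0 e0 n0); exists (f A x).
  suff : F [set B | hnorm (f B x - f A x) <= e] by [].
  apply: filterS FA => B /= BA.
  rewrite -[X in X <= _]/(hnorm ((f B - f A) x)).
  rewrite (le_trans (le_bop_norm _ _))//.
  rewrite (le_trans (ler_wpM2r (hnorm_ge0 _) BA))// mulrAC ler_pdivrMr//.
  by rewrite ler_wpM2l ?(ltW e0)// lerDl.
exists (fun x => sval (cid (lim x))) => e e0.
have e20 : 0 < e / 2 by rewrite divr_gt0.
have [A FA] := Fc _ e20; apply: filterS (FA) => B /= BA x.
case: cid => y /= Fy; apply/ler_addgt0Pr => d d0.
have [C /= [CA Cy]] := filter_ex (filterI FA (Fy _ d0)).
have -> : f B x - y = (f B - f A) x - (f C - f A) x + (f C x - y).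
  by rewrite -[(f B - f A) x]/(f B x - f A x) -[(f C - f A) x]/(f C x - f A x)
    opprB !addrA !subrK.
rewrite (le_trans (hnormD _ _))// lerD// (le_trans (hnormB _ _))//.
rewrite [e]splitr mulrDl lerD// (le_trans (le_bop_norm _ _))//.
  by rewrite ler_wpM2r ?BA ?hnorm_ge0.
by rewrite ler_wpM2r ?CA ?hnorm_ge0.
Qed.

(** The pointwise limits of a Cauchy filter and of its adjoints are adjoint to
    each other, so the limit is again an operator. *)
Lemma bop_complete (F : set_system bounded_op) :
  ProperFilter F -> cauchy F -> cvg F.
Proof.
move=> FF /cauchyP Fc.
have {}Fc e : 0 < e -> exists A, F [set B | `|B - A| <= e].
  move=> /Fc[A FA]; exists A; apply: filterS FA => B /=.
  by rewrite -ball_normE /= distrC => /ltW.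
have [T FT] := cauchy_pointwise (f := id) FF Fc.
have [S FS] : exists S : H -> H, forall e : R[i], 0 < e ->
    F [set B | forall x, hnorm (bop_star B x - S x) <= e * hnorm x].
  apply: cauchy_pointwise => e /Fc[A FA]; exists A.
  apply: filterS FA => B /=; apply: le_trans.
  by rewrite -bop_starN -bop_starD bop_norm_star_le.
have TS : adjoint_to T S.
  move=> x y; apply/eqP; rewrite -subr_eq0 -normr_eq0; apply/eqP/le_anti.
  rewrite normr_ge0 andbT; apply/ler_addgt0Pr => e e0; rewrite add0r.
  have xy0 : 0 <= hnorm x * hnorm y by rewrite mulr_ge0 ?hnorm_ge0.
  have n0 : 0 < 2 * (hnorm x * hnorm y + 1) by rewrite mulr_gt0// ltr_wpDl.
  pose d := e / (2 * (hnorm x * hnorm y + 1)).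
  have d0 : 0 < d by rewrite divr_gt0.
  have [B /= [BT BS]] := filter_ex (filterI (FT _ d0) (FS _ d0)).
  have -> : inner (T x) y - inner x (S y) =
      inner x (bop_star B y - S y) - inner (B x - T x) y.
    by rewrite innerDl innerDr innerNl innerNr -bop_starP; ring.
  rewrite (le_trans (ler_normB _ _))//.
  apply: (@le_trans _ _ (d * (2 * (hnorm x * hnorm y + 1)))); last first.
    by rewrite /d divfK ?gt_eqF.
  have -> : d * (2 * (hnorm x * hnorm y + 1)) =
      d * (hnorm x * hnorm y) + (d * (hnorm x * hnorm y) + (d + d)) by ring.
  rewrite lerD//.
    rewrite (le_trans (inner_le_hnorm _ _))// mulrCA ler_wpM2l ?hnorm_ge0 ?BS//.
  rewrite ler_wpDr ?addr_ge0 ?(ltW d0)//.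
  rewrite (le_trans (inner_le_hnorm _ _))// mulrA ler_wpM2r ?hnorm_ge0 ?BT//.
have TP : T \in adjointable.
  apply/adjointableP; split; first by exists S.
  have [B /= BT] := filter_ex (FT _ ltr01); exists (opnorm B + 1) => x.
  rewrite rmorphD rmorph1 mulrDl -[T x](subKr (B x)).
  by rewrite (le_trans (hnormB _ _))// lerD ?BT ?le_opnorm.
apply/cvg_ex; exists (BoundedOp TP); apply/cvgrPdist_le => e e0.
apply: filterS (FT _ e0) => B /= BT; rewrite distrC.
by apply: bop_norm_le; [exact: ltW|exact: BT].
Qed.

HB.instance Definition _ := Uniform_isComplete.Build bounded_op bop_complete.

Fact bop_mulDl A B C : bop_mul (A + B) C = bop_mul A C + bop_mul B C.
Proof. exact: bounded_op_ext. Qed.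

Fact bop_mulDr A B C : bop_mul A (B + C) = bop_mul A B + bop_mul A C.
Proof.
apply: bounded_op_ext => x.
by rewrite -[RHS]/(A (B x) + A (C x)) -[A (B x)]scale1r -bop_lin scale1r.
Qed.

Fact bop_mulZl (z : R[i]) A B : bop_mul (z *: A) B = z *: bop_mul A B.
Proof. exact: bounded_op_ext. Qed.

Fact bop_mulZr (z : R[i]) A B : bop_mul A (z *: B) = z *: bop_mul A B.
Proof.
apply: bounded_op_ext => x.
have A0 : A 0 = 0 by have := bopB A 0 0; rewrite !subrr.
by have := bop_lin A z (B x) 0; rewrite A0 !addr0.
Qed.

Fact bop_starK A : bop_star (bop_star A) = A.
Proof. by apply: bop_star_eq; apply: adjoint_to_sym; apply: bop_starP. Qed.

Fact bop_starM A B : bop_star (bop_mul A B) = bop_mul (bop_star B) (bop_star A).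
Proof. by apply: bop_star_eq => x y; rewrite /= !bop_starP. Qed.

Fact bop_mulA A B C : bop_mul A (bop_mul B C) = bop_mul (bop_mul A B) C.
Proof. exact: bounded_op_ext. Qed.

Definition operator_algebra : cstarAlgebra R :=
  CStarAlgebra bop_mulA bop_mulDl bop_mulDr bop_mulZl bop_mulZr
    bop_starK bop_starD bop_starZ bop_starM bop_norm_mul bop_norm_star.

End BoundedOperators.

(** * Square-summable families *)

Section ComplexLimits.
Context {R : realType} {T : Type} (F : set_system T) {FF : ProperFilter F}.
Implicit Types (u v : T -> R[i]) (l m a e : R[i]).

Definition clim u l := forall e, 0 < e -> F [set t | `|u t - l| <= e].

Lemma clim_unique u l m : clim u l -> clim u m -> l = m.
Proof.
move=> ul um; apply/eqP; rewrite -subr_eq0 -normr_eq0; apply/eqP/le_anti.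
rewrite normr_ge0 andbT; apply/ler_addgt0Pr => e e0; rewrite add0r.
have e20 : 0 < e / 2 by rewrite divr_gt0.
have [t /= [tl tm]] := filter_ex (filterI (ul _ e20) (um _ e20)).
rewrite -(subrKA (u t)) (le_trans (ler_normD _ _))// [e]splitr lerD//.
by rewrite distrC.
Qed.

Lemma clim_cst a : clim (fun=> a) a.
Proof. by move=> e e0; apply: filterE => t /=; rewrite subrr normr0 ltW. Qed.

Lemma climD u v l m : clim u l -> clim v m -> clim (fun t => u t + v t) (l + m).
Proof.
move=> ul vm e e0; have e20 : 0 < e / 2 by rewrite divr_gt0.
apply: filterS (filterI (ul _ e20) (vm _ e20)) => t /= [tl tm].
by rewrite opprD addrACA (le_trans (ler_normD _ _))// [e]splitr lerD.
Qed.

Lemma climZ a u l : clim u l -> clim (fun t => a * u t) (a * l).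
Proof.
move=> ul e e0; have a0 : 0 < `|a| + 1 by rewrite ltr_wpDl.
apply: filterS (ul _ (divr_gt0 e0 a0)) => t /=.
rewrite ler_pdivlMr// => tl; rewrite -mulrBr normrM mulrC; apply: le_trans tl.
by rewrite ler_wpM2l// lerDl.
Qed.

Lemma clim_conj u l : clim u l -> clim (fun t => Num.conj (u t)) (Num.conj l).
Proof.
move=> ul e e0; apply: filterS (ul _ e0) => t /=.
by rewrite -rmorphB norm_conjC.
Qed.

Lemma clim_norm u l : clim u l -> clim (fun t => `|u t|) `|l|.
Proof.
move=> ul e e0; apply: filterS (ul _ e0) => t /=; apply: le_trans.
exact: ler_dist_dist.
Qed.

Lemma clim_norm_le u l a : clim u l -> F [set t | `|u t| <= a] -> `|l| <= a.
Proof.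
move=> ul ua; apply/ler_addgt0Pr => e e0.
have [t /= [ta tl]] := filter_ex (filterI ua (ul _ e0)).
rewrite -[l](subKr (u t)) (le_trans (ler_normB _ _))// lerD//.
Qed.

Lemma clim_ge0 u l : clim u l -> F [set t | 0 <= u t] -> 0 <= l.
Proof.
move=> ul u0; rewrite (@clim_unique u l `|l|)// => e e0.
apply: filterS (filterI u0 (clim_norm ul e0)) => t /= [t0].
by rewrite (ger0_norm t0).
Qed.

Lemma clim_sqr u l : clim u l -> clim (fun t => `|u t| ^+ 2) (`|l| ^+ 2).
Proof.
move=> ul e e0; pose c := e + 1 + 2 * `|l|.
have c0 : 0 < c by rewrite ltr_wpDr ?mulr_ge0// addr_gt0.
have d0 : 0 < e / c by rewrite divr_gt0.
apply: filterS (ul _ d0) => t /= tl.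
have d1 : e / c <= 1 by rewrite ler_pdivrMr// mul1r /c -addrA lerDl addr_ge0 ?mulr_ge0.
rewrite subr_sqr normrM.
have tl1 : `| `|u t| - `|l| | <= e / c by rewrite (le_trans (ler_dist_dist _ _)).
rewrite -[leRHS](divfK (lt0r_neq0 c0)) ler_pM//.
rewrite ger0_norm ?addr_ge0//.
rewrite -[u t](subrK l) (le_trans (lerD (ler_normD _ _) (lexx _)))//.
rewrite -addrA -mulr2n -mulr_natl lerD2r (le_trans tl)// (le_trans d1)//.
by rewrite lerDr ltW.
Qed.

Lemma clim_sum I (r : seq I) (u : I -> T -> R[i]) (l : I -> R[i]) :
  (forall i, clim (u i) (l i)) ->
  clim (fun t => \sum_(i <- r) u i t) (\sum_(i <- r) l i).
Proof.
move=> ul; elim: r => [|i r IH].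
  by move=> e e0; apply: filterE => t /=; rewrite !big_nil subrr normr0 ltW.
have := climD (ul i) IH; rewrite big_cons => h e e0.
by apply: filterS (h _ e0) => t /=; rewrite big_cons.
Qed.

End ComplexLimits.

Lemma complex_complete (R : realType) (F : set_system R[i]) :
  ProperFilter F ->
  (forall e : R[i], 0 < e -> exists z, F [set w | `|w - z| <= e]) ->
  exists z, clim F id z.
Proof.
move=> FF Fc.
have part (f : R[i] -> R) : (forall z, `|f z|%:C%C <= `|z|) ->
    (forall z w, f (z - w) = f z - f w) ->
    exists r, forall e : R, 0 < e -> F [set w | `|f w - r| <= e].
  move=> fle fB; have GF := fmap_proper_filter f FF.
  have /R_complete/cvg_ex[r fr] : cauchy (f @ F).
    apply/cauchyP => e e0.
    have e20 : 0 < (e / 2)%:C%C by rewrite ltcR divr_gt0.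
    have [z Fz] := Fc _ e20.
    exists (f z). suff : F [set w | ball (f z) e (f w)] by [].
    apply: filterS Fz => w /= wz; rewrite -ball_normE /= distrC -fB.
    have : `|f (w - z)| <= e / 2 by rewrite -lecR (le_trans (fle _)).
    by move=> /le_lt_trans; apply; rewrite ltr_pdivrMr// ltr_pMr// ltr1n.
  exists r => e e0; move/cvgrPdist_le : fr => /(_ e e0).
  by apply: filterS => w; rewrite distrC.
have [r Fr] : exists r : R, forall e : R, 0 < e -> F [set w | `|complex.Re w - r| <= e].
  by apply: part => [z|[a b] [c d]] //; exact: normc_ge_Re.
have [s Fs] : exists s : R, forall e : R, 0 < e -> F [set w | `|complex.Im w - s| <= e].
  apply: part => [z|[a b] [c d]] //.
  have -> : complex.Im z = - complex.Re (z * 'i%C) by rewrite ReiNIm opprK.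
  rewrite normrN (le_trans (normc_ge_Re _))// normrM.
  by rewrite complexiE normCi mulr1.
exists (r +i* s)%C => e e0.
have /complex_realP[q qe] : e \is Num.real by rewrite gtr0_real.
have q0 : 0 < q / 2 by rewrite divr_gt0// -ltcR -qe.
apply: filterS (filterI (Fr _ q0) (Fs _ q0)) => w /= [wr ws].
rewrite (complexE (w - _)) (le_trans (ler_normD _ _))// qe [q]splitr rmorphD lerD//.
  by move: wr; rewrite -lecR; case: w ws => a b /=; rewrite normc_def /= expr0n addr0 sqrtr_sqr.
rewrite normrM complexiE normCi mul1r.
by move: ws; rewrite -lecR; case: w wr => a b /=; rewrite normc_def /= expr0n addr0 sqrtr_sqr.
Qed.

#[local] Existing Instance totally_filter.

Section SquareSummable.
Context {R : realType} {X : choiceType}.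
Implicit Types (u v f g h : X -> R[i]) (l : R[i]) (A B : {fset X}).

Definition psum u A := \sum_(i <- A) u i.

Definition has_sum u l := clim totally (psum u) l.

Definition summable_by u (M : R) := forall A, psum (fun i => `|u i|) A <= M%:C%C.

Lemma psum_ge0 u A : (forall i, 0 <= u i) -> 0 <= psum u A.
Proof. by move=> u0; apply: sumr_ge0 => i _. Qed.

Lemma psumD u v A : psum (fun i => u i + v i) A = psum u A + psum v A.
Proof. exact: big_split. Qed.

Lemma psumZ a u A : psum (fun i => a * u i) A = a * psum u A.
Proof. by rewrite /psum mulr_sumr. Qed.

Lemma psum_conj u A : psum (fun i => Num.conj (u i)) A = Num.conj (psum u A).
Proof. by rewrite /psum rmorph_sum. Qed.

Lemma psum_sub u A B : (A `<=` B)%fset ->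
  psum u B = psum u A + \sum_(i <- B | i \notin A) u i.
Proof.
move=> AB; rewrite /psum (bigID (fun i => i \in A)) /=; congr (_ + _).
rewrite -big_filter; apply: perm_big; apply: uniq_perm.
- by apply: filter_uniq; apply: fset_uniq.
- exact: fset_uniq.
- move=> i; rewrite mem_filter; apply: andb_idr => iA.
  by have := fsubsetP AB i iA.
Qed.

Lemma le_psum u A B : (forall i, 0 <= u i) -> (A `<=` B)%fset ->
  psum u A <= psum u B.
Proof.
by move=> u0 AB; rewrite (psum_sub u AB) lerDl sumr_ge0.
Qed.

Lemma has_sum_unique u l m : has_sum u l -> has_sum u m -> l = m.
Proof. exact: clim_unique. Qed.

Lemma eq_has_sum u v l : u =1 v -> has_sum u l -> has_sum v l.
Proof. by move=> /funext ->. Qed.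

Lemma has_sumD u v l m : has_sum u l -> has_sum v m ->
  has_sum (fun i => u i + v i) (l + m).
Proof.
by move=> ul vm; rewrite /has_sum (funext (psumD u v)); exact: climD.
Qed.

Lemma has_sumZ a u l : has_sum u l -> has_sum (fun i => a * u i) (a * l).
Proof.
by move=> ul; rewrite /has_sum (funext (psumZ a u)); exact: climZ.
Qed.

Lemma has_sum_conj u l : has_sum u l ->
  has_sum (fun i => Num.conj (u i)) (Num.conj l).
Proof.
by move=> ul; rewrite /has_sum (funext (psum_conj u)); exact: clim_conj.
Qed.

Lemma totally_sub A : @totally X [set B | (A `<=` B)%fset].
Proof. by exists A. Qed.

Lemma psum_le_sum u l A : (forall i, 0 <= u i) -> has_sum u l -> psum u A <= l.
Proof.
move=> u0 ul; rewrite -subr_ge0 addrC.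
apply: (clim_ge0 (climD (clim_cst (- psum u A)) ul)).
apply: filterS (totally_sub A) => B /= AB.
by rewrite addrC subr_ge0 le_psum.
Qed.

Lemma has_sum_ge0 u l : (forall i, 0 <= u i) -> has_sum u l -> 0 <= l.
Proof.
by move=> u0 ul; apply: clim_ge0 ul _; apply: filterE => A /=; apply: psum_ge0.
Qed.

Lemma has_sum_le u l M : (forall i, 0 <= u i) -> has_sum u l ->
  (forall A, psum u A <= M) -> l <= M.
Proof.
move=> u0 ul uM; rewrite -(ger0_norm (has_sum_ge0 u0 ul)).
apply: clim_norm_le ul _; apply: filterE => A /=.
by rewrite ger0_norm ?psum_ge0.
Qed.

(** Past a finite set that nearly attains the supremum of the sums of moduli,
    the partial sums vary little. *)
Lemma summable_has_sum u M : summable_by u M -> exists l, has_sum u l.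
Proof.
move=> uM; pose v i : R := Normc.normc (u i).
have vE i : `|u i| = (v i)%:C%C by [].
pose S := [set r | exists A, r = \sum_(i <- A) v i].
have SM : has_sup S.
  split; first by exists 0, fset0; rewrite big_seq_fset0.
  exists M => r [A ->]; rewrite -lecR rmorph_sum.
  exact: uM.
have GF := fmap_proper_filter (psum u) (@totally_filter X).
have [l ul] : exists l, clim (psum u @ totally) id l; last by exists l.
apply: complex_complete => e e0.
have /complex_realP[q qe] : e \is Num.real by rewrite gtr0_real.
have q0 : 0 < q by rewrite -ltcR -qe.
have [_ [A ->] Aq] := sup_adherent q0 SM.
exists (psum u A); exists A => // B /= AB.
rewrite (psum_sub u AB) addrC addKr (le_trans (ler_norm_sum _ _ _))//.
under eq_bigr do rewrite vE.
rewrite -rmorph_sum qe lecR -(lerD2l (\sum_(i <- A) v i)).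
have <- : \sum_(i <- B) v i = \sum_(i <- A) v i + \sum_(i <- B | i \notin A) v i.
  apply: complexI; rewrite rmorphD !rmorph_sum.
  exact: (psum_sub (fun i => `|u i|) AB).
rewrite -lerBlDr in Aq *; apply: le_trans (ltW Aq).
by rewrite lerD2r; apply: ub_le_sup; [exact: SM.2|exists B].
Qed.

Definition square_summable : {pred X -> R[i]} :=
  [pred f | `[< exists M, summable_by (fun i => `|f i| ^+ 2) M >]].

Lemma square_summableP f : reflect (exists M : R, forall A,
  psum (fun i => `|f i| ^+ 2) A <= M%:C%C) (f \in square_summable).
Proof.
apply: (iffP (asboolP _)) => -[M fM]; exists M => A; have := fM A.
  by congr (_ <= _); apply: eq_bigr => i _; rewrite normrX normr_id.
by congr (_ <= _); apply: eq_bigr => i _; rewrite normrX normr_id.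
Qed.

Lemma normD_sqr (a b : R[i]) : `|a + b| ^+ 2 <= 2 * `|a| ^+ 2 + 2 * `|b| ^+ 2.
Proof.
apply: (@le_trans _ _ ((`|a| + `|b|) ^+ 2)).
  by rewrite ler_pXn2r ?nnegrE ?addr_ge0// ler_normD.
rewrite -subr_ge0 (_ : _ - _ = (`|a| - `|b|) ^+ 2); last by ring.
by rewrite real_exprn_even_ge0// rpredB// normr_real.
Qed.

Lemma psum_normD_sqr f g A : psum (fun i => `|f i + g i| ^+ 2) A <=
  2 * psum (fun i => `|f i| ^+ 2) A + 2 * psum (fun i => `|g i| ^+ 2) A.
Proof.
rewrite -!psumZ -psumD; apply: ler_sum => i _; exact: normD_sqr.
Qed.

Lemma square_summable_submod : submod_closed square_summable.
Proof.
split=> [|a f g /square_summableP[M fM] /square_summableP[N gN]].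
  apply/square_summableP; exists 0 => A; rewrite /psum big1// => i _.
  by rewrite normr0 expr0n.
apply/square_summableP; exists (2 * (Normc.normc a ^+ 2 * M) + 2 * N) => A.
apply: le_trans (psum_normD_sqr (a *: f) g A) _.
have -> : (2 * (Normc.normc a ^+ 2 * M) + 2 * N)%:C%C =
    2 * (`|a| ^+ 2 * M%:C%C) + 2 * N%:C%C :> R[i].
  by rewrite rmorphD 2!rmorphM [X in _ * (X * _)]rmorphXn rmorphM rmorph_nat.
rewrite lerD ?ler_wpM2l//.
rewrite (_ : psum _ A = `|a| ^+ 2 * psum (fun i => `|f i| ^+ 2) A); last first.
  rewrite -psumZ; apply: eq_bigr => i _.
  by rewrite -exprMn -normrM.
by apply: (@ler_wpM2l _ (`|a| ^+ 2)); rewrite ?exprn_ge0.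
Qed.

HB.instance Definition _ :=
  GRing.isSubmodClosed.Build _ _ square_summable square_summable_submod.

End SquareSummable.

Section LittleL2.
Context (R : realType) (X : choiceType).

Record l2 := L2 {
  l2_val :> X -> R[i];
  _ : l2_val \in square_summable }.

HB.instance Definition _ := [isSub for l2_val].
HB.instance Definition _ := [Choice of l2 by <:].
HB.instance Definition _ := [SubChoice_isSubLmodule of l2 by <:].

Implicit Types f g h : l2.

Lemma l2P f : exists M : R, forall A, psum (fun i => `|f i| ^+ 2) A <= M%:C%C.
Proof. by case: f => f fP; apply/square_summableP. Qed.

Lemma l2_ext f g : f =1 g -> f = g.
Proof. by move=> e; apply/val_inj/funext. Qed.

Lemma l2_inner_ex f g : exists l, has_sum (fun i => f i * Num.conj (g i)) l.
Proof.
have [M fM] := l2P f; have [N gN] := l2P g.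
apply: (@summable_has_sum _ _ _ (M + N)) => A.
rewrite rmorphD; apply: le_trans (lerD (fM A) (gN A)).
rewrite -psumD; apply: ler_sum => i _; rewrite normrM norm_conjC.
have ab0 : 0 <= `|f i| * `|g i| by rewrite mulr_ge0.
rewrite -subr_ge0 (_ : _ - _ = (`|f i| - `|g i|) ^+ 2 + `|f i| * `|g i|); last by ring.
by rewrite addr_ge0// real_exprn_even_ge0// rpredB// normr_real.
Qed.

Definition l2_inner f g : R[i] := sval (cid (l2_inner_ex f g)).

Lemma l2_innerP f g : has_sum (fun i => f i * Num.conj (g i)) (l2_inner f g).
Proof. by rewrite /l2_inner; case: cid. Qed.

Lemma l2_inner_sqr f : has_sum (fun i => `|f i| ^+ 2) (l2_inner f f).
Proof. by apply: eq_has_sum (l2_innerP f f) => i; rewrite normCK. Qed.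

Fact l2_innerDl f g h : l2_inner (f + g) h = l2_inner f h + l2_inner g h.
Proof.
apply: has_sum_unique (l2_innerP _ _) _.
apply: eq_has_sum (has_sumD (l2_innerP f h) (l2_innerP g h)) => i.
by rewrite -mulrDl.
Qed.

Fact l2_innerZl a f g : l2_inner (a *: f) g = a * l2_inner f g.
Proof.
apply: has_sum_unique (l2_innerP _ _) _.
apply: eq_has_sum (has_sumZ a (l2_innerP f g)) => i.
by rewrite mulrA.
Qed.

Fact l2_innerC f g : l2_inner f g = Num.conj (l2_inner g f).
Proof.
apply: has_sum_unique (l2_innerP _ _) _.
apply: eq_has_sum (has_sum_conj (l2_innerP g f)) => i.
by rewrite rmorphM /= conjCK mulrC.
Qed.

Lemma sqr_norm_ge0 (z : R[i]) : 0 <= `|z| ^+ 2.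
Proof. exact: exprn_ge0. Qed.

Fact l2_inner_ge0 f : 0 <= l2_inner f f.
Proof. by apply: has_sum_ge0 (l2_inner_sqr f) => i; apply: sqr_norm_ge0. Qed.

Lemma l2_coord_le f i : `|f i| ^+ 2 <= l2_inner f f.
Proof.
have := psum_le_sum [fset i]%fset (fun j => sqr_norm_ge0 (f j)) (l2_inner_sqr f).
by rewrite /psum big_seq_fset1.
Qed.

Fact l2_inner_eq0 f : l2_inner f f = 0 -> f = 0.
Proof.
move=> f0; apply: l2_ext => i; apply/eqP; rewrite -normr_eq0 -sqrf_eq0.
by apply/eqP/le_anti; rewrite -{1}f0 l2_coord_le sqr_norm_ge0.
Qed.

Lemma l2_innerD_sqr f g :
  l2_inner (f + g) (f + g) <= 2 * l2_inner f f + 2 * l2_inner g g.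
Proof.
have psum_le h A := psum_le_sum A (fun j => sqr_norm_ge0 (h j)) (l2_inner_sqr h).
apply: has_sum_le (l2_inner_sqr _) _ => [i|A]; first exact: sqr_norm_ge0.
by rewrite (le_trans (psum_normD_sqr _ _ _))// lerD// ler_wpM2l// psum_le.
Qed.

Lemma l2_innerN f : l2_inner (- f) (- f) = l2_inner f f.
Proof.
rewrite -scaleN1r l2_innerZl l2_innerC l2_innerZl rmorphM /= -l2_innerC.
by rewrite mulrA rmorphN1 mulrNN mulr1 mul1r.
Qed.

(** A Cauchy filter converges in each coordinate; its bounds on finite partial
    sums pass to the limit. *)
Fact l2_complete (F : set_system l2) : ProperFilter F ->
  (forall e : R[i], 0 < e ->
    exists f, F [set g | sqrtC (l2_inner (g - f) (g - f)) <= e]) ->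
  exists f, forall e : R[i], 0 < e ->
    F [set g | sqrtC (l2_inner (g - f) (g - f)) <= e].
Proof.
move=> FF Fc.
have sqrt_le f (e : R[i]) : 0 <= e ->
    (sqrtC (l2_inner f f) <= e) = (l2_inner f f <= e ^+ 2).
  move=> e0; rewrite -[in RHS](sqrtCK (l2_inner f f)) ler_pXn2r ?nnegrE//.
  by rewrite sqrtC_ge0 l2_inner_ge0.
have coord i : exists z, clim F (fun f : l2 => f i) z.
  have GF := fmap_proper_filter (fun f : l2 => f i) FF.
  apply: (complex_complete GF) => e e0.
  have [f Ff] := Fc e e0; exists (f i).
  suff : F [set g : l2 | `|g i - f i| <= e] by [].
  apply: filterS Ff => g /=; rewrite sqrt_le ?(ltW e0)// => gf.
  rewrite -(@ler_pXn2r _ 2) ?nnegrE ?(ltW e0)//; apply: le_trans gf.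
  exact: (l2_coord_le (g - f)).
pose lim i := sval (cid (coord i)).
have limP i : clim F (fun f : l2 => f i) (lim i) by rewrite /lim; case: cid.
have fatou (e : R[i]) f : 0 < e -> F [set g | sqrtC (l2_inner (g - f) (g - f)) <= e] ->
    forall A, psum (fun i => `|lim i - f i| ^+ 2) A <= e ^+ 2.
  move=> e0 Ff A.
  have cvgA : clim F (fun g : l2 => psum (fun i => `|g i - f i| ^+ 2) A)
      (psum (fun i => `|lim i - f i| ^+ 2) A).
    by apply: clim_sum => i; apply: clim_sqr; apply: climD (limP i) (clim_cst _).
  rewrite -[leLHS]ger0_norm; last by apply: psum_ge0 => i; apply: sqr_norm_ge0.
  apply: clim_norm_le cvgA _; apply: filterS Ff => g /=; rewrite sqrt_le ?(ltW e0)//.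
  apply: le_trans; rewrite ger0_norm; last by apply: psum_ge0 => i; apply: sqr_norm_ge0.
  by apply: (psum_le_sum A _ (l2_inner_sqr (g - f))) => i; apply: sqr_norm_ge0.
have limL2 : lim \in square_summable.
  have [f Ff] := Fc 1 ltr01.
  have -> : lim = (lim \- f) \+ f by apply/funext => i /=; rewrite subrK.
  apply: rpredD; last by case: (f).
  apply/square_summableP; exists 1 => A; have := fatou _ _ ltr01 Ff A.
  by rewrite expr1n.
exists (L2 limL2) => e e0; have e20 : 0 < e / 2 by rewrite divr_gt0.
have [f Ff] := Fc _ e20; apply: filterS (Ff) => g /=; rewrite !sqrt_le ?(ltW e0) ?(ltW e20)// => gf.
have -> : g - L2 limL2 = (g - f) - (L2 limL2 - f) by rewrite opprB addrA subrK.
rewrite (le_trans (l2_innerD_sqr _ _))// l2_innerN.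
(* The inequality for squared norms loses a factor 2, hence radii e / 2. *)
have -> : e ^+ 2 = 2 * (e / 2) ^+ 2 + 2 * (e / 2) ^+ 2 by field.
rewrite lerD// ler_wpM2l//.
apply: (has_sum_le _ (l2_inner_sqr (L2 limL2 - f)) (fatou _ _ e20 Ff)) => i.
exact: sqr_norm_ge0.
Qed.

Definition l2_space : hilbertSpace R :=
  HilbertSpace l2_innerDl l2_innerZl l2_innerC l2_inner_ge0 l2_inner_eq0 l2_complete.

End LittleL2.

(** A partial injection comes with its inverse. Precomposition makes it act on
    square-summable families as a partial isometry, with the inverse acting as
    the adjoint. *)
Record pinj (X : Type) := PInj {
  pfun :> X -> option X;
  pinv : X -> option X;
  pinjP : forall x y, pfun x = Some y <-> pinv y = Some x }.

Section PartialInjections.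
Context {R : realType} {X : choiceType}.
Implicit Types (p q : pinj X) (f g : l2 R X) (u : X -> R[i]).

Definition pinj_inv p : pinj X :=
  PInj (fun x y => iff_sym (pinjP p y x)).

Definition pimage p (A : {fset X}) : {fset X} := [fset y in pmap p A]%fset.

Lemma psum_pinj p u A :
  psum (fun x => oapp u 0 (p x)) A = psum u (pimage p A).
Proof.
rewrite /psum -big_pmap; apply: perm_big; apply: uniq_perm.
- elim: (enum_fset A) (fset_uniq A) => //= x s IH /andP[xs us].
  case px: (p x) => [y|] /=; last exact: IH.
  rewrite IH // andbT; apply: contra xs; rewrite mem_pmap => /mapP[z zs py].
  suff -> : x = z by [].
  have /pinjP := px; have /pinjP := esym py.
  by move=> -> [->].
- exact: fset_uniq.
- by move=> y; rewrite in_fset.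
Qed.

Lemma mem_pimage p A x y : p x = Some y -> x \in A -> y \in pimage p A.
Proof.
by move=> pxy xA; rewrite in_fset /= mem_pmap; apply/mapP; exists x.
Qed.

(** The indices outside the range of [p] contribute nothing, so each finite sum
    over the domain is a finite sum over the range. *)
Lemma has_sum_pinj p u l : (forall y, pinv p y = None -> u y = 0) ->
  has_sum u l -> has_sum (fun x => oapp u 0 (p x)) l.
Proof.
move=> u0 ul e /ul[A _ uA]; exists (pimage (pinj_inv p) A) => // B /= AB.
rewrite psum_pinj.
have <- : psum u (A `|` pimage p B)%fset = psum u (pimage p B).
  rewrite (@psum_sub _ _ u (pimage p B)) ?fsubsetUr// big1_seq ?addr0// => y.
  move=> /andP[yB]; rewrite in_fsetU (negPf yB) orbF => yA.
  case py: (pinv p y) => [x|]; last exact: u0.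
  have xB : x \in B by apply: (fsubsetP AB); apply: mem_pimage yA.
  by rewrite (mem_pimage _ xB) in yB; rewrite // pinjP.
by apply: uA; rewrite /= fsubsetUl.
Qed.

Fact pinj_square_summable p f :
  (fun x => oapp f 0 (p x)) \in @square_summable R X.
Proof.
have [M fM] := l2P f; apply/square_summableP; exists M => A.
apply: le_trans (fM (pimage p A)); rewrite -psum_pinj le_eqVlt; apply/orP; left.
by apply/eqP/eq_bigr => x _; case: (p x) => [y|] //=; rewrite normr0 expr0n.
Qed.

Definition pinj_act p f : l2 R X := L2 (pinj_square_summable p f).

Lemma pinj_act_adjoint p :
  @adjoint_to R (l2_space R X) (pinj_act p) (pinj_act (pinj_inv p)).
Proof.
move=> f g; apply: has_sum_unique (l2_innerP (pinj_act p f) g) _.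
pose u y := f y * Num.conj (oapp g 0 (pinv p y)).
have u0 y : pinv p y = None -> u y = 0.
  by rewrite /u => -> /=; rewrite conjC0 mulr0.
have := has_sum_pinj u0 (l2_innerP f (pinj_act (pinj_inv p) g)).
apply: eq_has_sum => x /=; case px: (p x) => [y|] /=; last by rewrite mul0r.
by have /pinjP := px; rewrite /u => ->.
Qed.

Lemma pinj_act_bounded p : @bounded_by R (l2_space R X) (pinj_act p) 1.
Proof.
move=> f; rewrite rmorph1 mul1r /hnorm ler_sqrtC ?qualifE /= ?l2_inner_ge0//.
have sum_f := l2_inner_sqr (pinj_act p f).
apply: has_sum_le (sum_f) _ => [x|A]; first exact: sqr_norm_ge0.
apply: le_trans (psum_le_sum (pimage p A) _ (l2_inner_sqr f)); last first.
  by move=> x; exact: sqr_norm_ge0.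
rewrite -psum_pinj le_eqVlt; apply/orP; left.
by apply/eqP/eq_bigr => x _ /=; case: (p x) => [y|] //=; rewrite normr0 expr0n.
Qed.

Fact pinj_adjointable p : (pinj_act p : l2_space R X -> l2_space R X) \in @adjointable R (l2_space R X).
Proof.
apply/adjointableP; split; last by exists 1; exact: pinj_act_bounded.
by exists (pinj_act (pinj_inv p)); exact: pinj_act_adjoint.
Qed.

Definition pinj_op p : operator_algebra (l2_space R X) := BoundedOp (pinj_adjointable p).

Lemma pinj_opE p f x : (pinj_op p : bounded_op _) f x = oapp f 0 (p x).
Proof. by []. Qed.

Lemma pinj_op_star p : cstar (pinj_op p) = pinj_op (pinj_inv p).
Proof. by apply: bop_star_eq; exact: pinj_act_adjoint. Qed.

Lemma pinj_op_mulE p q f x : (cmul (pinj_op p) (pinj_op q) : bounded_op _) f x =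
  oapp f 0 (obind q (p x)).
Proof. by rewrite /= ; case: (p x). Qed.

End PartialInjections.

(** * Infinite paths and compact cylinders *)

Section KGraphPaths.
Context {k : nat} (L : kgraph k).
Implicit Types (a b m mu nu v : L) (n p q : Nk k) (x y z : infpath L).

Lemma leNk_refl n : leNk n n.
Proof. by apply/forallP. Qed.

Lemma kfactor_uniq a b a' b' : ksrc a = krng b -> ksrc a' = krng b' ->
  kdeg a = kdeg a' -> kdeg b = kdeg b' -> kcomp a b = kcomp a' b' ->
  a = a' /\ b = b'.
Proof.
move=> ab ab' da db e.
have [c [_ uc]] := kfactor (kdeg_comp ab).
have h : (a, b) = (a', b').
  by rewrite -(uc (a, b)) ?(uc (a', b'))//; split; rewrite /= ?e.
by case: h.
Qed.

Definition kprefix a m := exists2 b, ksrc a = krng b & m = kcomp a b.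

Lemma kprefix_refl a : kprefix a a.
Proof. by exists (ksrc a); rewrite ?krng_src ?kcomp_idr. Qed.

Lemma kprefix_trans a b m : kprefix a b -> kprefix b m -> kprefix a m.
Proof.
move=> [c ac ->] [d]; rewrite ksrc_comp// => cd ->.
by exists (kcomp c d); rewrite ?krng_comp ?kcompA.
Qed.

Lemma kprefix_comp a b : ksrc a = krng b -> kprefix a (kcomp a b).
Proof. by exists b. Qed.

Lemma kprefix_compl a b c : ksrc a = krng c -> kprefix b c ->
  kprefix (kcomp a b) (kcomp a c).
Proof.
move=> ac [d bd cE]; move: ac; rewrite cE krng_comp// => ab.
by exists d; rewrite ?ksrc_comp ?kcompA.
Qed.

Lemma kprefix_rng a m : kprefix a m -> krng a = krng m.
Proof. by move=> [b ab ->]; rewrite krng_comp. Qed.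

Lemma kprefix_eq a a' m : kprefix a m -> kprefix a' m -> kdeg a = kdeg a' -> a = a'.
Proof.
move=> [b ab ->] [b' ab' e] aa'; apply: proj1 (kfactor_uniq ab ab' aa' _ e).
by have := congr1 (@kdeg _ _) e; rewrite !kdeg_comp// aa' => /addNkI.
Qed.

Lemma kprefix_ex n m : leNk n (kdeg m) -> exists2 a, kprefix a m & kdeg a = n.
Proof.
case/leNkP => q /kfactor [[a b] [[/= -> <- _ ab] _]].
by exists a => //; exact: kprefix_comp.
Qed.

Lemma kprefix_le a b m : kprefix a m -> kprefix b m -> leNk (kdeg a) (kdeg b) ->
  kprefix a b.
Proof.
move=> am bm /kprefix_ex[c cb ca].
by rewrite -(kprefix_eq (kprefix_trans cb bm) am ca).
Qed.

Lemma kdeg0_id v : kdeg v = 0 -> krng v = v /\ ksrc v = v.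
Proof.
move=> v0; have [] := @kfactor_uniq v (ksrc v) (krng v) v.
- by rewrite krng_src.
- by rewrite ksrc_rng.
- by rewrite kdeg_id v0.
- by rewrite -[ksrc v]krng_src kdeg_id v0.
- by rewrite kcomp_idl kcomp_idr.
by [].
Qed.

Lemma kvertices_src mu : kvertices (ksrc mu).
Proof. by rewrite -krng_src; exact: kdeg_id. Qed.

Lemma kvertices_rng mu : kvertices (krng mu).
Proof. exact: kdeg_id. Qed.

Lemma segment_prefix x n q : kprefix (segment x 0 n) (segment x 0 (n + q)).
Proof.
rewrite segment_comp; apply: kprefix_comp.
by rewrite segment_src segment_rng.
Qed.

(** The initial segment of degree [n] is only asked to begin [rho n]: paths are
    built from segments of whatever degree is at hand, and cut back here. The
    piece between [p] and [p + n] is what unique factorization adds to the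
    segment of degree [p], and its uniqueness makes the pieces a functor. *)
Lemma coherent_infpath (rho : Nk k -> L) :
  (forall n, leNk n (kdeg (rho n))) ->
  (forall n q, kprefix (rho n) (rho (n + q))) ->
  exists x, forall n, kprefix (segment x 0 n) (rho n).
Proof.
move=> rho_deg rho_coh.
have /choice[la laP] : forall n, exists a, kprefix a (rho n) /\ kdeg a = n.
  by move=> n; have [a] := kprefix_ex (rho_deg n); exists a.
have la_rho n : kprefix (la n) (rho n) by case: (laP n).
have la_deg n : kdeg (la n) = n by case: (laP n).
have /choice[t tP] : forall pn : Nk k * Nk k, exists b,
    ksrc (la pn.1) = krng b /\ la (pn.1 + pn.2) = kcomp (la pn.1) b.
  move=> [p n] /=; suff [b] : kprefix (la p) (la (p + n)) by exists b.
  apply: (kprefix_le (kprefix_trans (la_rho p) (rho_coh p n)) (la_rho _)).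
  by rewrite !la_deg leNk_add.
have t_src p n : ksrc (la p) = krng (t (p, n)) by case: (tP (p, n)).
have t_comp p n : la (p + n) = kcomp (la p) (t (p, n)) by case: (tP (p, n)).
have t_deg p n : kdeg (t (p, n)) = n.
  by have := congr1 (@kdeg _ _) (t_comp p n); rewrite kdeg_comp// !la_deg => /addNkI.
have t_id p : t (p, 0) = ksrc (la p).
  have := t_comp p 0; rewrite addr0 -{1}(kcomp_idr (la p)).
  move/kfactor_uniq => h; have [] := h; rewrite ?krng_src ?t_deg//.
  by rewrite -krng_src kdeg_id.
have t_end p n : ksrc (t (p, n)) = ksrc (la (p + n)) by rewrite t_comp ksrc_comp.
pose x (a : @omega_kgraph k) := t ((val (a : @omega_mor k)).1, kdeg a).
have xE p n : x (om p n) = t (p, n) by rewrite /x /= subNkDl.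
have omP (a : @omega_mor k) : exists p n, a = om p n.
  by exists (val a).1, (subNk (val a).2 (val a).1); exact: omE.
have xP : kfunctor x.
  split=> [a|a|a|a b].
  - by rewrite /x t_deg.
  - have [p [n ->]] := omP a; rewrite xE -t_src -t_id -xE.
    by [].
  - have [p [n ->]] := omP a; rewrite xE t_end -t_id -xE.
    by [].
  - have [p [n ->]] := omP a; have [p' [q ->]] := omP b.
    move=> /(congr1 val)/(congr1 fst) /= <-.
    transitivity (x (om p (n + q))); first by congr x; exact: omega_compE.
    rewrite !xE.
    have tt : ksrc (t (p, n)) = krng (t (p + n, q)) by rewrite t_end; exact: t_src.
    have [] // := @kfactor_uniq (la p) (t (p, n + q)) (la p) (kcomp (t (p, n)) (t (p + n, q))).
    + by rewrite krng_comp.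
    + by rewrite kdeg_comp// !t_deg.
    + by rewrite -t_comp kcompA// -!t_comp addrA.
exists (InfPath xP) => n; rewrite /segment /= xE.
suff -> : t (0, n) = la n by exact: la_rho.
have := t_comp 0 n; rewrite add0r => ->.
have [_ e0] := kdeg0_id (la_deg 0).
by rewrite -[la 0]e0 (t_src 0 n) kcomp_idl.
Qed.

Lemma prefixed_ex mu x : infpaths_at (ksrc mu) x -> exists y, prefixed mu x y.
Proof.
move=> xmu; have mux n : ksrc mu = krng (segment x 0 n) by rewrite segment_rng xmu.
have [n|n q|y yP] := @coherent_infpath (fun n => kcomp mu (segment x 0 n)).
- by rewrite kdeg_comp// segment_deg addrC leNk_add.
- exact: kprefix_compl (segment_prefix _ _ _).
have y_mu : segment y 0 (kdeg mu) = mu.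
  by apply: kprefix_eq (yP _) (kprefix_comp (mux _)) _; rewrite segment_deg.
exists y; apply/prefixedP; split=> //; apply: infpath_eq0 => n.
rewrite segment_shift addr0.
have yn : segment y 0 (kdeg mu + n) = kcomp mu (segment x 0 n).
  apply: kprefix_eq (yP _) _ _; last by rewrite kdeg_comp// !segment_deg.
  by apply: kprefix_compl => //; rewrite addrC; exact: segment_prefix.
move: yn; rewrite segment_comp add0r y_mu => /kfactor_uniq[]//.
- by rewrite segment_rng -{1}y_mu segment_src add0r.
- by rewrite !segment_deg.
Qed.

(** Without sources, a vertex extends by one edge of each colour at a time,
    and the degrees of these extensions exceed any given degree. *)
Lemma infpath_ex v : source_free L -> kvertices v -> infpaths_at v !=set0.
Proof.
move=> sf v0; pose one : Nk k := [ffun=> 1%N].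
have /choice[step stepP] : forall mu, exists e, kpaths_at (ksrc mu) one e.
  by move=> mu; apply/sf/kvertices_src.
pose walk := fix walk j := if j is j'.+1 then kcomp (walk j') (step (walk j')) else v.
have step_comp mu : ksrc mu = krng (step mu) by case: (stepP mu).
have walk_deg j i : kdeg (walk j) i = j.
  elim: j => [|j IH] /=; first by rewrite v0 ffunE.
  rewrite kdeg_comp// ffunE IH; case: (stepP (walk j)) => -> _.
  by rewrite ffunE [LHS]addn1.
have walk_prefix j i : kprefix (walk j) (walk (j + i)%N).
  elim: i => [|i IH]; first by rewrite addn0; exact: kprefix_refl.
  by rewrite addnS; apply: kprefix_trans IH (kprefix_comp _).
pose mx (n : Nk k) := (\max_i n i)%N.
have [n|n q|x xP] := @coherent_infpath (fun n => walk (mx n)).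
- by apply/forallP => i; rewrite walk_deg; exact: leq_bigmax.
- suff /subnKC <- : (mx n <= mx (n + q)%R)%N by exact: walk_prefix.
  by apply/bigmax_leqP => i _; apply: leq_trans (leq_bigmax i); rewrite ffunE leq_addr.
exists x; rewrite /infpaths_at /= -(segment_rng x 0 0) (kprefix_rng (xP 0)).
have /kprefix_rng <- := walk_prefix 0%N (mx 0).
by case: (kdeg0_id v0).
Qed.

Lemma gpd_ext (g h : path_groupoid L) : gpd_val g = gpd_val h -> g = h.
Proof.
by case: g h => [g gP] [h hP] /= e; subst h; congr PathGroupoid; exact: Prop_irrelevance.
Qed.

Lemma nbhs_gpd (g : path_groupoid L) U : nbhs g U ->
  exists W, [/\ gpd_basis W, W g & W `<=` U].
Proof.
move=> [_ [[D Dbasis <-] [W DW Wg] WU]]; exists W; split=> //; first exact: Dbasis.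
by move=> h Wh; apply: WU; exists W.
Qed.

Lemma open_gpd_basis (W : set (path_groupoid L)) : gpd_basis W -> open W.
Proof.
by move=> Wb; exists [set W]; rewrite ?bigcup_set1// => _ ->.
Qed.

Lemma ultra_finite_bigcup T (I : choiceType) (F : set_system T) (D : set I) (A : I -> set T) :
  UltraFilter F -> finite_set D -> F (\bigcup_(i in D) A i) ->
  exists2 i, D i & F (A i).
Proof.
move=> FU /finite_seqP[s ->]; elim: s => [|i s IH] FA.
  have [g [j]] := filter_ex FA.
  by rewrite /= in_nil.
have [FAi|FnAi] := in_ultra_setVsetC (A i) FU.
  by exists i => //=; rewrite inE eqxx.
have /IH[j js FAj] : F (\bigcup_(j in [set` s]) A j).
  apply: filterS (filterI FA FnAi) => t [[j /=]]; rewrite inE => /predU1P[->//|js] Aj _.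
  by exists j.
by exists j => //=; rewrite inE (js : j \in s) orbT.
Qed.

(** By row-finiteness, an ultrafilter on the cylinder picks a path of each
    degree that begins the common tail of almost all its elements. These paths
    are the initial segments of a path [x], and the limit is the element of the
    cylinder with tail [x]. *)
Lemma gpd_cylinder_compact mu nu : row_finite L -> ksrc mu = ksrc nu ->
  compact (gpd_cylinder mu nu).
Proof.
move=> rf munu; rewrite compact_ultra => F FU FZ.
pose tl (g : path_groupoid L) := shift (gpd_rng g) (kdeg mu).
have ZP g : gpd_cylinder mu nu g -> [/\ infpaths_at (ksrc mu) (tl g),
    prefixed mu (tl g) (gpd_rng g), prefixed nu (tl g) (gpd_src g)
    & gpd_deg g = diffZk (kdeg mu) (kdeg nu)].
  move=> [x [xr xs dg]]; have [xat _ _] := xr.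
  by have /prefixedP[_ tlx] := xr; rewrite /tl tlx.
have /choice[la laP] : forall n, exists la,
    F [set g | gpd_cylinder mu nu g /\ segment (tl g) 0 n = la].
  move=> n; have [|la _ Fla] := @ultra_finite_bigcup _ _ F (kpaths_at (ksrc mu) n)
    (fun la => [set g | gpd_cylinder mu nu g /\ segment (tl g) 0 n = la]) FU
    (rf _ n (kvertices_src mu)); last by exists la.
  apply: filterS FZ => g Zg; exists (segment (tl g) 0 n) => //.
  split; first exact: segment_deg.
  by have [<- _ _ _] := ZP _ Zg; rewrite segment_rng.
have la_deg n : kdeg (la n) = n.
  by have [g [_ <-]] := filter_ex (laP n); rewrite segment_deg.
have [n|n q|x xla] := @coherent_infpath la.
- by rewrite la_deg leNk_refl.
- have [g [[_ <-] [_ <-]]] := filter_ex (filterI (laP n) (laP (n + q))).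
  exact: segment_prefix.
have {}xla n : segment x 0 n = la n.
  by apply: kprefix_eq (xla n) (kprefix_refl _) _; rewrite segment_deg la_deg.
have xmu : infpaths_at (ksrc mu) x.
  have [g [Zg tl0]] := filter_ex (laP 0).
  by have [<- _ _ _] := ZP g Zg; rewrite /infpaths_at /= xla -tl0.
have [y muy] := prefixed_ex xmu.
have [z nuz] : exists z, prefixed nu x z by apply: prefixed_ex; rewrite -munu.
have g0P : in_path_groupoid (y, diffZk (kdeg mu) (kdeg nu), z).
  by exists mu, nu, x.
pose g0 := PathGroupoid g0P.
have Zg0 : gpd_cylinder mu nu g0 by exists x.
exists g0; split=> // U /nbhs_gpd[W [[[a b] /= ab <-] abg0 WU]].
pose J : Nk k := [ffun i => maxn (kdeg mu i) (kdeg a i)].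
pose n := subNk J (kdeg mu); pose q := subNk J (kdeg a).
have e1 : kdeg mu + n = kdeg a + q.
  apply/ffunP => i; rewrite !ffunE.
  exact: etrans (subnKC (leq_maxl _ _)) (esym (subnKC (leq_maxr _ _))).
have e2 : kdeg nu + n = kdeg b + q.
  have [_ [_ _ h1]] := abg0.
  apply/ffunP => i; move/ffunP: e1 => /(_ i); move/ffunP: h1 => /(_ i).
  have nE (c d : nat) : c + d = (c + d)%N by [].
  rewrite /gpd_deg /= !ffunE !nE.
  by move: (kdeg mu i) (kdeg nu i) (kdeg a i) (kdeg b i) (n i) (q i) => c d e f; lia.
apply: filterS (laP n) => g [Zg tlg]; apply: WU.
have [_ sub] := gpd_cylinder_sub q abg0; apply: sub.
rewrite -e1 -e2 /gpd_rng /gpd_src /=.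
have [/prefixedP[y1 y2] /prefixedP[z1 z2]] := (muy, nuz).
have [_ /prefixedP[r1 r2] /prefixedP[s1 s2] dg] := ZP g Zg.
have xn : segment x 0 n = segment (tl g) 0 n by rewrite xla tlg.
have seg_eq (m : L) (u w : infpath L) : segment u 0 (kdeg m) = m ->
    segment w 0 (kdeg m) = m -> shift u (kdeg m) = x -> shift w (kdeg m) = tl g ->
    segment w 0 (kdeg m + n) = segment u 0 (kdeg m + n).
  move=> u1 w1 u2 w2; rewrite !segment_comp u1 w1 add0r.
  have := xn; rewrite -{1}u2 -{1}w2 !segment_shift addr0 => -> //.
exists (shift (tl g) n); split.
- apply/prefixedP; rewrite segment_deg; split; first exact: (seg_eq mu).
  by rewrite -r2 shiftD.
- apply/prefixedP; rewrite segment_deg; split; first exact: (seg_eq nu).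
  by rewrite -[in RHS]s2 shiftD.
- rewrite dg !segment_deg; apply/ffunP => i; rewrite !ffunE.
  have nE (c d : nat) : c + d = (c + d)%N by [].
  rewrite !nE.
  by move: (kdeg mu i) (kdeg nu i) (n i) => c d e; lia.
Qed.

End KGraphPaths.

(** * The representation on paths with a degree *)

HB.instance Definition _ k (L : kgraph k) := gen_eqMixin (infpath L).
HB.instance Definition _ k (L : kgraph k) := gen_choiceMixin (infpath L).

Section PathSpaceRepresentation.
Context {k : nat} (L : kgraph k).
Implicit Types (mu nu v : L) (n p q : Nk k) (x y z : infpath L).

Definition zdeg n : Zk k := [ffun i => (n i)%:Z].

Lemma zdegD p q : zdeg (p + q) = zdeg p + zdeg q.
Proof. by apply/ffunP => i; rewrite !ffunE PoszD. Qed.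

Lemma zdeg0 : zdeg 0 = 0.
Proof. by apply/ffunP => i; rewrite !ffunE. Qed.

Lemma diffZkE p q : diffZk p q = zdeg p - zdeg q.
Proof. by apply/ffunP => i; rewrite !ffunE. Qed.

(** The degree remembers the middle coordinate of the elements of the path
    groupoid: on infinite paths alone, the operators [s_a s_b^*] and
    [s_c s_d^*] could agree although the cylinders of [(a, b)] and [(c, d)]
    are disjoint. *)
Definition gpath : choiceType := (infpath L * Zk k)%type.
Implicit Types P Q : gpath.

Definition kunshift mu P : option gpath :=
  if segment P.1 0 (kdeg mu) == mu
  then Some (shift P.1 (kdeg mu), P.2 - zdeg (kdeg mu)) else None.

(** The default path is never returned when [P] starts at the source of [mu]. *)
Definition kprepend mu P : option gpath :=
  if segment P.1 0 0 == ksrc mu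
  then Some (xget P.1 [set y | prefixed mu P.1 y], P.2 + zdeg (kdeg mu)) else None.

Lemma kunshiftP mu P Q : kunshift mu P = Some Q <->
  prefixed mu Q.1 P.1 /\ P.2 = Q.2 + zdeg (kdeg mu).
Proof.
case: P Q => [y m] [x n]; rewrite /kunshift /=; split.
  case: eqP => // ymu [<- <-]; rewrite subrK; split=> //.
  by apply/prefixedP.
by move=> [/prefixedP[-> <-] ->]; rewrite eqxx addrK.
Qed.

Lemma kprependP mu P Q : kprepend mu Q = Some P <->
  prefixed mu Q.1 P.1 /\ P.2 = Q.2 + zdeg (kdeg mu).
Proof.
case: P Q => [y m] [x n]; rewrite /kprepend /=; split.
  case: eqP => // xmu [<- <-]; split=> //.
  have [z xz] := prefixed_ex xmu.
  by have := @xgetPex _ x [set y | prefixed mu x y] (ex_intro _ z xz).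
move=> [xy ->]; have [xmu _ _] := xy; rewrite xmu eqxx; congr (Some (_, _)).
by apply: (prefixed_inj _ xy); exact: (@xgetPex _ x [set y | prefixed mu x y] (ex_intro _ y xy)).
Qed.

Definition kshift mu : pinj gpath :=
  PInj (fun P Q => iff_trans (kunshiftP mu P Q) (iff_sym (kprependP mu P Q))).

Lemma kunshift_vertex v P : kvertices v ->
  kunshift v P = if segment P.1 0 0 == v then Some P else None.
Proof.
move=> v0; rewrite /kunshift v0 zdeg0 subr0; case: P => y m /=.
suff -> : shift y 0 = y by [].
by apply: infpath_eq => p q; rewrite segment_shift add0r.
Qed.

Lemma kprepend_vertex v P : kvertices v -> kprepend v P = kunshift v P.
Proof.
move=> v0; rewrite kunshift_vertex //.
have [_ vs] := kdeg0_id v0.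
case: eqP => Pv; last by rewrite /kprepend vs; case: eqP.
apply/kprependP; rewrite v0 zdeg0 addr0; split=> //; apply/prefixedP.
rewrite v0 Pv; split=> //.
by apply: infpath_eq => p q; rewrite segment_shift add0r.
Qed.

Lemma kunshift_comp mu nu P : ksrc mu = krng nu ->
  kunshift (kcomp mu nu) P = obind (kunshift nu) (kunshift mu P).
Proof.
move=> munu; rewrite /kunshift kdeg_comp// segment_comp add0r zdegD.
have -> : (kcomp (segment P.1 0 (kdeg mu)) (segment P.1 (kdeg mu) (kdeg nu)) ==
    kcomp mu nu) = (segment P.1 0 (kdeg mu) == mu) &&
    (segment (shift P.1 (kdeg mu)) 0 (kdeg nu) == nu).
  rewrite segment_shift addr0; apply/eqP/andP => [e|[/eqP-> /eqP-> //]].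
  have [|||e1 e2] := kfactor_uniq _ munu _ _ e; last by rewrite e1 e2 !eqxx.
  - by rewrite segment_src segment_rng add0r.
  - exact: segment_deg.
  - exact: segment_deg.
case: eqP => //= _; rewrite shiftD opprD addrA.
by case: eqP.
Qed.

Context {R : realType}.

(** Precomposition with the removal of [mu]: the operator that puts [mu] in
    front of paths. *)
Definition path_op mu : operator_algebra (l2_space R gpath) := pinj_op (kshift mu).

Lemma path_op_ext (S T : operator_algebra (l2_space R gpath)) :
  (forall (f : l2 R gpath) P, ((S : bounded_op _) f : l2 R gpath) P =
    ((T : bounded_op _) f : l2 R gpath) P) -> S = T.
Proof. by move=> ST; apply: bounded_op_ext => f; apply: l2_ext => P; apply: ST. Qed.

Lemma path_op_star mu : cstar (path_op mu) = pinj_op (pinj_inv (kshift mu)).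
Proof. exact: pinj_op_star. Qed.

Lemma path_op_comp mu nu : ksrc mu = krng nu ->
  path_op (kcomp mu nu) = cmul (path_op mu) (path_op nu).
Proof.
move=> munu; apply: path_op_ext => f P.
by rewrite pinj_op_mulE pinj_opE /= kunshift_comp.
Qed.

Lemma path_op_src mu : cmul (cstar (path_op mu)) (path_op mu) = path_op (ksrc mu).
Proof.
rewrite path_op_star; apply: path_op_ext => f P.
rewrite pinj_op_mulE pinj_opE /= kunshift_vertex; last exact: kvertices_src.
case Pmu: (kprepend mu P) => [Q|] /=.
  have -> : kunshift mu Q = Some P by apply/(pinjP (kshift mu)).
  by move: Pmu; rewrite /kprepend; case: eqP.
by move: Pmu; rewrite /kprepend; case: eqP.
Qed.

Lemma path_op_rngE mu (f : l2 R gpath) P :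
  ((cmul (path_op mu) (cstar (path_op mu)) : bounded_op _) f : l2 R gpath) P =
  if segment P.1 0 (kdeg mu) == mu then f P else 0.
Proof.
rewrite path_op_star pinj_op_mulE /=.
case Pmu: (kunshift mu P) => [Q|] /=.
  have -> : kprepend mu Q = Some P by apply/(pinjP (kshift mu)).
  by move: Pmu; rewrite /kunshift; case: eqP.
by move: Pmu; rewrite /kunshift; case: eqP.
Qed.

Lemma bop_sumE I (r : seq I) (S : I -> operator_algebra (l2_space R gpath))
    (f : l2 R gpath) P :
  (((\sum_(i <- r) S i : operator_algebra _) : bounded_op _) f : l2 R gpath) P =
  \sum_(i <- r) ((S i : bounded_op _) f : l2 R gpath) P.
Proof.
elim: r => [|i r IH]; first by rewrite !big_nil.
by rewrite !big_cons -IH.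
Qed.

Lemma path_op_ck : row_finite L -> ck_family path_op.
Proof.
move=> rf; split=> [mu|].
  rewrite /cpartial_isometry -cmulA path_op_src -path_op_comp ?krng_src//.
  by rewrite kcomp_idr.
split.
- move=> v v0; split.
    split.
      rewrite path_op_star; apply: path_op_ext => f P.
      by rewrite !pinj_opE /= kprepend_vertex.
    have [vr vs] := kdeg0_id v0; rewrite -path_op_comp ?vr ?vs//.
    by rewrite -{1}vr kcomp_idl.
  move=> w w0 vw; apply: path_op_ext => f P; rewrite pinj_op_mulE /=.
  rewrite kunshift_vertex//; case: eqP => //= Pv.
  by rewrite kunshift_vertex//; case: eqP => // Pw; case: vw; rewrite -Pv -Pw.
- exact: path_op_comp.
- exact: path_op_src.
- move=> v n v0; apply: path_op_ext => f P.
  have fin := rf v n v0; rewrite fsbig_finite//= bop_sumE.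
  under eq_bigr do rewrite path_op_rngE.
  rewrite kunshift_vertex//.
  have segP : segment P.1 0 n \in fset_set (kpaths_at v n) -> segment P.1 0 0 = v.
    by rewrite in_fset_set// inE => -[_ <-]; rewrite segment_rng.
  case: eqP => Pv; last first.
    rewrite big1_seq// => mu /andP[_ muP]; case: eqP => // e; case: Pv.
    move: (muP); rewrite in_fset_set// inE => -[/= dmu _].
    by apply: segP; rewrite -{1}dmu e.
  have Pn : segment P.1 0 n \in fset_set (kpaths_at v n).
    rewrite in_fset_set// inE; split; first exact: segment_deg.
    by rewrite segment_rng.
  rewrite (bigD1_seq (segment P.1 0 n)) ?fset_uniq//= segment_deg eqxx.
  rewrite big1_seq ?addr0// => mu /andP[muP].
  rewrite in_fset_set// inE => -[/= dmu _].
  by rewrite dmu eq_sym (negPf muP).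
Qed.

Fact delta_square_summable P :
  (fun Q : gpath => (Q == P)%:R) \in @square_summable R gpath.
Proof.
apply/square_summableP; exists 1 => A.
rewrite /psum (bigID (pred1 P)) /= [X in _ + X]big1 ?addr0; last first.
  by move=> Q /negPf ->; rewrite normr0 expr0n.
rewrite (eq_bigr (fun=> 1)) => [|Q /eqP ->]; last by rewrite eqxx normr1 expr1n.
rewrite big_const_seq iter_addr_0 count_uniq_mem ?fset_uniq//.
by case: (P \in A); rewrite ?ler01 ?lexx.
Qed.

Definition delta P : l2 R gpath := L2 (delta_square_summable P).

Lemma sum_deltaE (l : seq gpath) Q : (\sum_(P <- l) delta P : l2 R gpath) Q = (count_mem Q l)%:R.
Proof.
elim: l => [|P l IH]; first by rewrite big_nil.
rewrite big_cons /= natrD -IH; congr (_ + _).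
by rewrite /= eq_sym.
Qed.

Lemma sum_delta_perm (l l' : seq gpath) :
  \sum_(P <- l) delta P = \sum_(P <- l') delta P -> perm_eq l l'.
Proof.
move=> e; apply/allP => Q _ /=; rewrite -(eqr_nat R[i]) -!sum_deltaE.
by rewrite e.
Qed.

(** A list of pairs [(a, b)] is a formal sum of the elements [s_a s_b^*], and
    acts on paths by the partial maps [b x |-> a x]. *)
Definition spanval (A : cstarAlgebra R) (s : L -> A) (E : seq (L * L)) : A :=
  \sum_(e <- E) cmul (s e.1) (cstar (s e.2)).

Definition pair_act (e : L * L) P : option gpath :=
  obind (kprepend e.1) (kunshift e.2 P).

Definition act (E : seq (L * L)) P : seq gpath := pmap (pair_act^~ P) E.

Lemma pair_act_sym (e : L * L) P Q :
  pair_act e P = Some Q <-> pair_act (e.2, e.1) Q = Some P.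
Proof.
suff h (a b : L) P' Q' : pair_act (a, b) P' = Some Q' -> pair_act (b, a) Q' = Some P'.
  by split; case: e => a b; exact: h.
rewrite /pair_act /=; case bP: (kunshift b P') => [S|] //= aS.
have -> : kunshift a Q' = Some S by apply/(pinjP (kshift a)).
by apply/(pinjP (kshift b)).
Qed.

(** The matrix coefficients of a formal sum count how often it maps a path to
    another. *)
Lemma spanval_delta E P :
  ((spanval path_op E : bounded_op _) (delta P) : l2 R gpath) =
  \sum_(Q <- act E P) delta Q.
Proof.
apply: l2_ext => Q; rewrite bop_sumE sum_deltaE /act.
elim: E => [|e E IH]; first by rewrite big_nil.
rewrite big_cons IH path_op_star pinj_op_mulE /=.
have -> : oapp (delta P) 0 (obind (kprepend e.2) (kunshift e.1 Q)) =
    (pair_act e P == Some Q)%:R :> R[i].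
  rewrite -/(pair_act (e.2, e.1) Q).
  case eQ: (pair_act (e.2, e.1) Q) => [S|] /=.
    congr (nat_of_bool _)%:R; apply/eqP/eqP => [<-|].
      by move/pair_act_sym: eQ; rewrite /= -surjective_pairing.
    by move/pair_act_sym; rewrite eQ => -[].
  by case: eqP => // /pair_act_sym; rewrite eQ.
case: (pair_act e P) => [S|] /=; last by rewrite add0r.
by rewrite natrD.
Qed.

Lemma bop_suml (T : operator_algebra (l2_space R gpath)) I (r : seq I) (f : I -> l2 R gpath) :
  ((T : bounded_op _) (\sum_(i <- r) f i) : l2 R gpath) =
  \sum_(i <- r) ((T : bounded_op _) (f i) : l2 R gpath).
Proof.
have T0 : (T : bounded_op _) 0 = 0 by have := bopB (T : bounded_op _) 0 0; rewrite !subrr.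
elim: r => [|i r IH]; first by rewrite !big_nil.
rewrite !big_cons -IH.
by have := bop_lin (T : bounded_op _) 1 (f i) (\sum_(j <- r) f j); rewrite !scale1r.
Qed.

Lemma spanval_morph (A B : cstarAlgebra R) (s : L -> A) (t : L -> B)
    (f : {linear A -> B}) E : star_morphism f -> (forall mu, f (s mu) = t mu) ->
  f (spanval s E) = spanval t E.
Proof.
move=> [fM fS] fs; rewrite linear_sum /=; apply: eq_bigr => e _.
by rewrite fM fS !fs.
Qed.

Section UniversalFamily.
Variables (A : cstarAlgebra R) (s : L -> A).
Hypotheses (L_row_finite : row_finite L) (s_univ : universal_ck_family s).

(** By universality the value of a formal sum determines its operator on paths,
    and thus its action with multiplicities. *)
Lemma act_perm E E' P : spanval s E = spanval s E' -> perm_eq (act E P) (act E' P).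
Proof.
case: s_univ => _ _ /(_ _ path_op (path_op_ck L_row_finite))[f fstar fs] e.
apply: sum_delta_perm; rewrite -!spanval_delta.
by rewrite -!(spanval_morph _ fstar fs) e.
Qed.

Lemma act_mul E E' E'' P : spanval s E'' = cmul (spanval s E) (spanval s E') ->
  perm_eq (act E'' P) (flatten [seq act E Q | Q <- act E' P]).
Proof.
case: s_univ => _ _ /(_ _ path_op (path_op_ck L_row_finite))[f fstar fs] e.
apply: sum_delta_perm; rewrite -spanval_delta -(spanval_morph _ fstar fs) e.
rewrite (proj1 fstar) !(spanval_morph _ fstar fs).
transitivity ((spanval path_op E : bounded_op _) ((spanval path_op E' : bounded_op _) (delta P))).
  by [].
rewrite spanval_delta bop_suml big_flatten big_map /=.
by apply: eq_bigr => Q _; rewrite spanval_delta.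
Qed.

End UniversalFamily.

End PathSpaceRepresentation.

(** * Formal sums in a Cuntz-Krieger algebra *)

Section CuntzKriegerAlgebra.
Context {R : realType} {k : nat} (L : kgraph k) (A : cstarAlgebra R) (s : L -> A).
Hypotheses (L_row_finite : row_finite L) (s_ck : ck_family s).
Implicit Types (mu nu a b v : L) (n : Nk k) (E : seq (L * L)).

Lemma ck_vertex v : kvertices v -> cprojection (s v).
Proof. by case: s_ck => _ [h _ _ _] /h[]. Qed.

Lemma ck_vertex_orth v w : kvertices v -> kvertices w -> v <> w -> cmul (s v) (s w) = 0.
Proof. by case: s_ck => _ [h _ _ _] /h[_]; apply. Qed.

Lemma ck_comp mu nu : ksrc mu = krng nu -> s (kcomp mu nu) = cmul (s mu) (s nu).
Proof. by case: s_ck => _ [_ h _ _]; apply: h. Qed.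

Lemma ck_src mu : cmul (cstar (s mu)) (s mu) = s (ksrc mu).
Proof. by case: s_ck => _ [_ _ h _]; apply: h. Qed.

Lemma ck_sum v n : kvertices v ->
  s v = \sum_(mu <- fset_set (kpaths_at v n)) cmul (s mu) (cstar (s mu)).
Proof.
case: s_ck => _ [_ _ _ h] v0; rewrite (h v n v0) fsbig_finite//.
exact: L_row_finite.
Qed.

Lemma ck_partial_isometry mu : cmul (cmul (s mu) (cstar (s mu))) (s mu) = s mu.
Proof. by case: s_ck => h _; apply: h. Qed.

Lemma ck_rngl mu : cmul (s (krng mu)) (s mu) = s mu.
Proof. by rewrite -ck_comp ?kcomp_idl// ksrc_rng. Qed.

Lemma ck_srcr mu : cmul (s mu) (s (ksrc mu)) = s mu.
Proof. by rewrite -ck_comp ?kcomp_idr// krng_src. Qed.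

Lemma ck_rng_projection mu : cprojection (cmul (s mu) (cstar (s mu))).
Proof.
split; first by rewrite cstarM cstarK.
by rewrite cmulA ck_partial_isometry.
Qed.

(** The range projections of the paths of a given degree from a vertex add up
    to the projection of this vertex, so they are orthogonal. *)
Lemma ck_orthogonal mu nu : kdeg mu = kdeg nu -> mu <> nu ->
  cmul (cstar (s mu)) (s nu) = 0.
Proof.
move=> dd neq; have [rr|/eqP rr] := eqVneq (krng mu) (krng nu); last first.
  rewrite -[s mu]ck_rngl -[s nu]ck_rngl cstarM -cmulA [X in cmul _ X]cmulA.
  have [-> _] := ck_vertex (kvertices_rng mu).
  by rewrite ck_vertex_orth ?cmul0l ?cmul0r//; exact: kvertices_rng.
pose p la := cmul (s la) (cstar (s la)).
pose D := enum_fset (fset_set (kpaths_at (krng mu) (kdeg mu))).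
have fin := L_row_finite (kdeg mu) (kvertices_rng mu).
have memD la : (la \in D) = (la \in kpaths_at (krng mu) (kdeg mu)) by exact: in_fset_set.
have muD : mu \in D by rewrite memD; apply: mem_set.
have nuD : nu \in rem mu D.
  rewrite mem_rem_uniq ?fset_uniq// inE /= memD; apply/andP; split.
    by apply/eqP/nesym.
  by apply: mem_set.
have permD : perm_eq D [:: mu, nu & rem nu (rem mu D)].
  by rewrite (permPl (perm_to_rem muD)) perm_cons perm_to_rem.
have orth : cmul (p mu) (p nu) = 0.
  apply: (@sum_projections_orthogonal _ _ (s (krng mu)) _ _ (map p (rem nu (rem mu D)))).
  - have sub x : x \in [:: mu, nu & rem nu (rem mu D)] -> krng x = krng mu.
      by rewrite -(perm_mem permD) memD => /set_mem[].
    move=> x; rewrite -[X in x \in X]/(map p [:: mu, nu & rem nu (rem mu D)]).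
    move=> /mapP[la /sub rla ->]; split; first exact: ck_rng_projection.
    by rewrite /p cmulA -rla ck_rngl.
  - exact/ck_vertex/kvertices_rng.
  - rewrite -[X in \sum_(_ <- X) _]/(map p [:: mu, nu & rem nu (rem mu D)]) big_map.
    by rewrite -(perm_big _ permD) /= -ck_sum//; exact: kvertices_rng.
have e1 : cmul (cstar (s mu)) (p mu) = cstar (s mu).
  by rewrite -[in RHS](ck_partial_isometry mu) !cstarM cstarK.
have e2 : cmul (p nu) (s nu) = s nu by exact: ck_partial_isometry.
by rewrite -e1 -e2 -cmulA [X in cmul _ X]cmulA orth cmul0l cmul0r.
Qed.

Lemma cidentity_uniq (e e' : A) : cidentity e -> cidentity e' -> e = e'.
Proof. by move=> /(_ e')[ee' _] /(_ e)[_ ee]; rewrite -ee' ee. Qed.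

Definition wf_pairs E := all (fun e => ksrc e.1 == ksrc e.2) E.

Definition swap_pairs E : seq (L * L) := [seq (e.2, e.1) | e <- E].

Lemma wf_swap E : wf_pairs (swap_pairs E) = wf_pairs E.
Proof. by rewrite /wf_pairs all_map; apply: eq_all => e /=; rewrite eq_sym. Qed.

Lemma spanval_swap E : spanval s (swap_pairs E) = cstar (spanval s E).
Proof.
rewrite /spanval big_map cstar_sum; apply: eq_bigr => e _ /=.
by rewrite cstarM cstarK.
Qed.

Lemma swap_pairsK : involutive swap_pairs.
Proof.
by move=> E; rewrite /swap_pairs -map_comp -[RHS]map_id; apply: eq_map => -[].
Qed.

Definition extend_pair n (e : L * L) : seq (L * L) :=
  [seq (kcomp e.1 c, kcomp e.2 c) | c <- fset_set (kpaths_at (ksrc e.1) n)].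

Lemma mem_extension a n c : c \in fset_set (kpaths_at (ksrc a) n) ->
  kdeg c = n /\ ksrc a = krng c.
Proof.
by rewrite in_fset_set ?inE => [[]|]; last exact/L_row_finite/kvertices_src.
Qed.

(** Insert [s_v = sum s_c s_c^*] between [s_a] and [s_b^*]. *)
Lemma spanval_extend_pair n (e : L * L) : ksrc e.1 = ksrc e.2 ->
  spanval s (extend_pair n e) = cmul (s e.1) (cstar (s e.2)).
Proof.
case: e => a b /= ab; rewrite /spanval big_map.
rewrite -[in RHS](ck_srcr a) (ck_sum n (kvertices_src a)) cmul_sumr cmul_suml.
apply: eq_big_seq => c /mem_extension[_ ac] /=.
rewrite (ck_comp ac) ck_comp; last by rewrite -ab.
by rewrite cstarM !cmulA.
Qed.

Lemma refine_left E N : wf_pairs E -> (forall e, e \in E -> leNk (kdeg e.1) N) ->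
  exists E', [/\ wf_pairs E', spanval s E' = spanval s E
    & forall e, e \in E' -> kdeg e.1 = N].
Proof.
move=> wf EN.
exists (flatten [seq extend_pair (subNk N (kdeg e.1)) e | e <- E]); split.
- apply/allP => f /flatten_mapP[e eE /mapP[c /mem_extension[_ ac] ->]] /=.
  have /eqP ee := allP wf _ eE.
  by rewrite !ksrc_comp -?ee.
- rewrite /spanval big_flatten big_map; apply: eq_big_seq => e eE.
  by apply: spanval_extend_pair; apply/eqP; exact: (allP wf).
- move=> f /flatten_mapP[e eE /mapP[c /mem_extension[dc ac] ->]] /=.
  rewrite kdeg_comp// dc; have /leNkP[q ->] := EN e eE.
  by rewrite subNkDl.
Qed.

Lemma refine_right E N : wf_pairs E -> (forall e, e \in E -> leNk (kdeg e.2) N) ->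
  exists E', [/\ wf_pairs E', spanval s E' = spanval s E
    & forall e, e \in E' -> kdeg e.2 = N].
Proof.
move=> wf EN; have [||E' [wf' sE' dE']] := @refine_left (swap_pairs E) N.
- by rewrite wf_swap.
- by move=> f /mapP[e /EN ? ->].
exists (swap_pairs E'); split; rewrite ?wf_swap//.
  by rewrite spanval_swap sE' spanval_swap cstarK.
by move=> f /mapP[e /dE' ? ->].
Qed.

Lemma degree_bound (I : eqType) (r : seq I) (d : I -> Nk k) N :
  exists2 M, leNk N M & forall i, i \in r -> leNk (d i) M.
Proof.
elim: r => [|i r [M NM rM]]; first by exists N; rewrite ?leNk_refl.
exists (M + d i) => [|j]; last rewrite inE => /predU1P[->|/rM jM].
- by apply/forallP => x; rewrite ffunE (leq_trans (forallP NM x))// leq_addr.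
- by apply/forallP => x; rewrite ffunE leq_addl.
- by apply/forallP => x; rewrite ffunE (leq_trans (forallP jM x))// leq_addr.
Qed.

(** Once the middle degrees agree, [s_b^* s_c] vanishes unless [b = c]. *)
Lemma spanval_mul E E' : wf_pairs E -> wf_pairs E' -> exists2 E'', wf_pairs E'' &
  spanval s E'' = cmul (spanval s E) (spanval s E').
Proof.
move=> wfE wfE'.
have [M _ EM] := degree_bound E (fun e => kdeg e.2) 0.
have [N MN EN] := degree_bound E' (fun e => kdeg e.1) M.
have {}EM e : e \in E -> leNk (kdeg e.2) N.
  by move=> /EM eM; apply/forallP => x; rewrite (leq_trans (forallP eM x)) ?(forallP MN x).
have [F [wfF <- dF]] := refine_right wfE EM.
have [F' [wfF' <- dF']] := refine_left wfE' EN.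
exists (flatten [seq [seq (e.1, e'.2) | e' <- F' & e.2 == e'.1] | e <- F]).
  apply/allP => f /flatten_mapP[e eF /mapP[e']]; rewrite mem_filter => /andP[/eqP ee e'F' ->] /=.
  by rewrite (eqP (allP wfF _ eF)) ee (eqP (allP wfF' _ e'F')).
rewrite /spanval big_flatten big_map cmul_suml; apply: eq_big_seq => e eF.
rewrite cmul_sumr big_map big_filter big_mkcond; apply: eq_big_seq => e' e'F' /=.
rewrite -[RHS]cmulA [X in _ = cmul _ X]cmulA; case: eqP => ee; last first.
  by rewrite (ck_orthogonal _ ee) ?cmul0l ?cmul0r ?dF ?dF'.
by rewrite -ee ck_src cmulA -{1}(eqP (allP wfF _ eF)) ck_srcr.
Qed.

Hypotheses (s_gen : cgenerated (range s)) (L_fin : finite_set (@kvertices k L)).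

Definition vertex_pairs : seq (L * L) := [seq (v, v) | v <- fset_set (@kvertices k L)].

Lemma wf_vertex_pairs : wf_pairs vertex_pairs.
Proof. by apply/allP => f /mapP[v _ ->] /=. Qed.

(** The elements on which the sum of the vertex projections acts as a unit form
    a closed *-subalgebra containing the generators. *)
Lemma spanval_vertex_pairs : cidentity (spanval s vertex_pairs).
Proof.
set e := spanval s vertex_pairs.
have eE : e = \sum_(v <- fset_set (@kvertices k L)) s v.
  rewrite /e /spanval big_map; apply: eq_big_seq => v.
  by rewrite in_fset_set// inE => /ck_vertex[vs vv] /=; rewrite vs vv.
have es : cstar e = e by rewrite /e -spanval_swap /swap_pairs -map_comp.
have vertex_in v : kvertices v -> v \in fset_set (@kvertices k L).
  by move=> v0; rewrite in_fset_set//; apply: mem_set.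
have emu mu : cmul e (s mu) = s mu.
  rewrite eE cmul_suml (bigD1_seq _ (vertex_in _ (kvertices_rng mu)) (fset_uniq _)) /=.
  rewrite ck_rngl big1_seq ?addr0// => v /andP[/eqP vmu].
  rewrite in_fset_set// inE => v0; rewrite -[s mu]ck_rngl cmulA.
  by rewrite ck_vertex_orth ?cmul0l//; exact: kvertices_rng.
have mue mu : cmul (s mu) e = s mu.
  rewrite eE cmul_sumr (bigD1_seq _ (vertex_in _ (kvertices_src mu)) (fset_uniq _)) /=.
  rewrite ck_srcr big1_seq ?addr0// => v /andP[/eqP vmu].
  rewrite in_fset_set// inE => v0; rewrite -[s mu]ck_srcr -cmulA.
  by rewrite ck_vertex_orth ?cmul0r//; [exact: kvertices_src|exact/nesym].
suff unitA : [set a | cmul e a = a /\ cmul a e = a] = setT.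
  by move=> a; have : [set: A] a by []; rewrite -unitA.
apply: s_gen; last by move=> _ [mu _ <-].
split.
- move=> a cla.
  have small (b : A) : (forall c, cmul e c = c -> cmul c e = c ->
      `|b| <= (`|e| + 1) * `|a - c|) -> b = 0.
    move=> bc; apply/eqP; rewrite -normr_eq0; apply/eqP/le_anti.
    rewrite normr_ge0 andbT; apply/ler_addgt0Pr => d d0; rewrite add0r.
    have e0 : 0 < `|e| + 1 by rewrite ltr_wpDl.
    have [c [[ec ce]]] := cla _ (nbhsx_ballx a _ (divr_gt0 d0 e0)).
    rewrite -ball_normE /= ltr_pdivlMr// mulrC => /ltW.
    exact: le_trans (bc c ec ce).
  split; apply/eqP; rewrite -subr_eq0; apply/eqP/small => c ec ce.
  + have -> : cmul e a - a = cmul e (a - c) - (a - c).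
      by rewrite cmulDr cmulNr ec opprB addrA subrK.
    rewrite (le_trans (ler_normB _ _))// mulrDl mul1r lerD//.
    exact: cnormM.
  + have -> : cmul a e - a = cmul (a - c) e - (a - c).
      by rewrite cmulDl cmulNl ce opprB addrA subrK.
    rewrite (le_trans (ler_normB _ _))// mulrDl mul1r lerD// mulrC.
    exact: cnormM.
- split; first by rewrite /= cmul0l cmul0r.
  by move=> z a b [ea ae] [eb be]; split; rewrite ?cmulDr ?cmulDl ?cmulZr ?cmulZl ?ea ?eb ?ae ?be.
- move=> a b [ea ae] [eb be]; split; first by rewrite cmulA ea.
  by rewrite -cmulA be.
- by move=> a [ea ae]; split; rewrite -{1}es -cstarM ?ae ?ea.
Qed.

End CuntzKriegerAlgebra.

(** * Formal sums as subsets of the path groupoid *)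

Section PairActions.
Context {k : nat} (L : kgraph k).
Implicit Types (e : L * L) (E : seq (L * L)) (P Q : gpath L) (g h t : path_groupoid L).

Lemma pair_actP e P Q : pair_act e P = Some Q <-> exists S : gpath L,
  [/\ prefixed e.2 S.1 P.1, P.2 = S.2 + zdeg (kdeg e.2),
      prefixed e.1 S.1 Q.1 & Q.2 = S.2 + zdeg (kdeg e.1)].
Proof.
rewrite /pair_act; split.
  case PS: (kunshift e.2 P) => [S|] //= SQ; exists S.
  by have /kunshiftP[] := PS; have /kprependP[] := SQ.
move=> [S [p1 p2 q1 q2]].
have -> : kunshift e.2 P = Some S by apply/kunshiftP.
by apply/kprependP.
Qed.

Lemma mem_act E P Q : reflect (exists2 e, e \in E & pair_act e P = Some Q) (Q \in act E P).
Proof.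
rewrite mem_pmap; apply: (iffP mapP) => -[e eE]; first by move=> ->; exists e.
by move=> ePQ; exists e.
Qed.

Lemma count_mem_act E P Q :
  count_mem Q (act E P) = count (fun e => pair_act e P == Some Q) E.
Proof.
elim: E => //= e E IH; case: (pair_act e P) => [S|] /=; last by rewrite IH.
by rewrite IH.
Qed.

Lemma count_mem_act_swap E P Q :
  count_mem P (act (swap_pairs E) Q) = count_mem Q (act E P).
Proof.
rewrite !count_mem_act count_map; apply: eq_count => e /=.
by apply/eqP/eqP => /pair_act_sym //=; rewrite -surjective_pairing.
Qed.

Lemma mem_act_swap E P Q : (P \in act (swap_pairs E) Q) = (Q \in act E P).
Proof. by rewrite -!has_pred1 !has_count count_mem_act_swap. Qed.

(** The images of [P] and [Q] determine both degrees, and then [e.1] and [e.2]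
    are initial segments of [Q] and [P]. *)
Lemma act_eq_pair e e' P Q : pair_act e P = Some Q -> pair_act e' P = Some Q ->
  kdeg e.1 = kdeg e'.1 -> e = e'.
Proof.
move=> /pair_actP[S [/prefixedP[p1 _] p2 /prefixedP[q1 _] q2]].
move=> /pair_actP[S' [/prefixedP[p1' _] p2' /prefixedP[q1' _] q2']] d1.
have S2 : S.2 = S'.2 by apply: (addIr (zdeg (kdeg e.1))); rewrite -q2 d1 -q2'.
have d2 : kdeg e.2 = kdeg e'.2.
  have : zdeg (kdeg e.2) = zdeg (kdeg e'.2) by apply: (addrI S.2); rewrite -p2 S2 -p2'.
  by move=> /ffunP h; apply/ffunP => i; have := h i; rewrite !ffunE => -[].
apply/eqP; rewrite -pair_eqE /pair_eq -q1 -q1' -p1 -p1' /= d1 d2.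
by rewrite q1' p1' !eqxx.
Qed.

Lemma pair_act_shift e P Q (j : Zk k) : pair_act e P = Some Q ->
  pair_act e (P.1, P.2 + j) = Some (Q.1, Q.2 + j).
Proof.
move=> /pair_actP[S [p1 p2 q1 q2]]; apply/pair_actP; exists (S.1, S.2 + j).
by split; rewrite //= ?p2 ?q2 addrAC.
Qed.

Lemma mem_act_shift E (x y : infpath L) (m n j : Zk k) :
  ((x, n + j) \in act E (y, m + j)) = ((x, n) \in act E (y, m)).
Proof.
apply/mem_act/mem_act => -[e eE /pair_act_shift ePQ]; exists e => //.
by have := ePQ (- j); rewrite /= !addrK.
Qed.

(** The union of the cylinders of the pairs in [E], see [pairs_setE]; this form
    relates it to the action. *)
Definition pairs_set E : set (path_groupoid L) :=
  [set g | (gpd_rng g, gpd_deg g) \in act E (gpd_src g, 0)].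

Lemma pairs_setE E : pairs_set E = \bigcup_(e in [set` E]) gpd_cylinder e.1 e.2.
Proof.
apply/seteqP; split=> [g /mem_act[e eE /pair_actP[S /= [p1 p2 q1 q2]]]|g [e /= eE]].
  exists e => //; exists S.1; split=> //.
  by rewrite q2 diffZkE addrC; congr (_ + _); apply/eqP; rewrite -addr_eq0 -p2.
move=> [x [p1 p2 dg]]; apply/mem_act; exists e => //; apply/pair_actP.
exists (x, - zdeg (kdeg e.2)); split=> //=; first by rewrite addNr.
by rewrite dg diffZkE addrC.
Qed.

Lemma act_pairs_set E (x y : infpath L) (m n : Zk k) : wf_pairs E ->
  (x, n) \in act E (y, m) ->
  exists2 g, pairs_set E g & [/\ gpd_rng g = x, gpd_deg g = n - m & gpd_src g = y].
Proof.
move=> wf xy; have gP : in_path_groupoid (x, n - m, y).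
  have /mem_act[e eE /pair_actP[S /= [p1 p2 q1 q2]]] := xy.
  exists e.1, e.2, S.1; split=> //; first exact/eqP/(allP wf).
  by rewrite /= p2 q2 diffZkE opprD addrACA subrr add0r.
exists (PathGroupoid gP) => //; rewrite /pairs_set /= /gpd_rng /gpd_deg /gpd_src /=.
by rewrite -(mem_act_shift _ _ _ _ _ m) subrK add0r.
Qed.

Lemma pairs_set_act E g (m : Zk k) : pairs_set E g ->
  (gpd_rng g, gpd_deg g + m) \in act E (gpd_src g, m).
Proof. by move=> gE; rewrite -[X in (gpd_src g, X)]add0r mem_act_shift. Qed.

(** [E] acts as a permutation: it sends each path to one path, once, and so
    does the transposed sum. *)
Definition permutes E :=
  forall P, size (act E P) = 1%N /\ size (act (swap_pairs E) P) = 1%N.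

Lemma size1_eq (T : eqType) (r : seq T) x y : size r = 1%N -> x \in r -> y \in r -> x = y.
Proof. by case: r => [|z [|]] //= _; rewrite !inE => /eqP -> /eqP ->. Qed.

Lemma size1_mem (T : eqType) (r : seq T) : size r = 1%N -> exists x, x \in r.
Proof. by case: r => [|z [|]] // _; exists z; rewrite inE. Qed.

Lemma compact_pairs_set E : row_finite L -> wf_pairs E -> compact (pairs_set E).
Proof.
rewrite pairs_setE => rf; elim: E => [|e E IH] wf.
  suff -> : [set` [::]] = set0 :> set (L * L) by rewrite bigcup_set0; exact: compact0.
  by apply/seteqP; split.
have -> : [set` e :: E] = [set e] `|` [set` E].
  apply/seteqP; split=> e' /=; rewrite inE.
    by case/predU1P => [->|]; [left|right].
  by case=> [->|->]; rewrite ?eqxx ?orbT.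
rewrite bigcup_setU bigcup_set1; move: wf => /andP[/eqP we wE].
apply: compactU; [exact: gpd_cylinder_compact|exact: IH].
Qed.

Lemma open_pairs_set E : wf_pairs E -> open (pairs_set E).
Proof.
rewrite pairs_setE => wf; apply: bigcup_open => e eE; apply: open_gpd_basis.
by exists e => //; exact/eqP/(allP wf).
Qed.

(** Uniqueness of images under [E] and its transpose makes source and range
    injective; existence makes them surjective. *)
Lemma permutes_full_bisection E : row_finite L -> wf_pairs E -> permutes E ->
  full_bisections (pairs_set E).
Proof.
move=> rf wf pE; split; last 2 first.
- exact: compact_pairs_set.
- exact: open_pairs_set.
- split=> g h; rewrite !inE => gE hE gh; apply: gpd_ext.
    have gP : (gpd_src g, - gpd_deg g) \in act (swap_pairs E) (gpd_rng g, 0).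
      by have := pairs_set_act (- gpd_deg g) gE; rewrite subrr -mem_act_swap.
    have hP : (gpd_src h, - gpd_deg h) \in act (swap_pairs E) (gpd_rng g, 0).
      by have := pairs_set_act (- gpd_deg h) hE; rewrite subrr -mem_act_swap gh.
    have [es /oppr_inj ed] := size1_eq (proj2 (pE _)) gP hP.
    move: gh es ed; rewrite /gpd_rng /gpd_src /gpd_deg.
    by case: (gpd_val g) (gpd_val h) => [[? ?] ?] [[? ?] ?] /= -> -> ->.
  have [er ed] := size1_eq (proj1 (pE _)) gE (eq_ind_r (fun y => _ \in act E (y, 0)) hE gh).
  move: gh er ed; rewrite /gpd_rng /gpd_src /gpd_deg.
  by case: (gpd_val g) (gpd_val h) => [[? ?] ?] [[? ?] ?] /= -> -> ->.
- split; apply/seteqP; split=> // y _.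
    have [[x n] /act_pairs_set[//|g gE [_ _ gy]]] := size1_mem (proj1 (pE (y, 0))).
    by exists g.
  have [[x n]] := size1_mem (proj2 (pE (y, 0))).
  rewrite mem_act_swap => /act_pairs_set[//|g gE [gy _ _]].
  by exists g.
Qed.

Lemma compact_open_pairs (W : set (path_groupoid L)) : compact W -> open W ->
  exists2 E, wf_pairs E & pairs_set E = W.
Proof.
move=> Wc Wo.
pose D := [set e : L * L | ksrc e.1 = ksrc e.2 /\ gpd_cylinder e.1 e.2 `<=` W].
have [W0|[g0 _]] : W = set0 \/ W !=set0.
  by have [->|/set0P] := eqVneq W set0; [left|right].
  exists [::] => //; rewrite W0 pairs_setE.
  suff -> : [set` [::]] = set0 :> set (L * L) by rewrite bigcup_set0.
  by apply/seteqP; split.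
(* [compact_cover] is about pointed spaces. *)
pose T : ptopologicalType :=
  HB.pack (path_groupoid L) (isPointed.Build (path_groupoid L) g0).
have : @cover_compact T W by rewrite -(@compact_cover T); exact: Wc.
move=> /(_ (L * L)%type D (fun e => gpd_cylinder e.1 e.2)).
case=> [e [ee _]|g Wg|D' D'D WD'].
- by apply: open_gpd_basis; exists e.
- have [V [[e /= ee <-] eg eW]] := nbhs_gpd (open_nbhs_nbhs (conj Wo Wg)).
  by exists e.
exists (enum_fset D').
  by apply/allP => e /D'D /set_mem[/eqP].
rewrite pairs_setE; apply/seteqP; split=> [g [e /= eD' eg]|g /WD' [e eD' eg]].
  by have /set_mem[_] := D'D _ eD'; apply.
by exists e.
Qed.

End PairActions.

(** * The isomorphism *)

Section HigmanThompson.
Context {R : realType} {k : nat} (L : kgraph k) (A : cstarAlgebra R) (s : L -> A).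
Hypotheses (L_row_finite : row_finite L) (L_source_free : source_free L).
Hypotheses (L_fin : finite_set (@kvertices k L)) (s_univ : universal_ck_family s).
Implicit Types (E F : seq (L * L)) (P Q : gpath L) (U V : A).

Let s_ck : ck_family s. Proof. by case: s_univ. Qed.
Let s_gen : cgenerated (range s). Proof. by case: s_univ. Qed.

(** Once both sums are refined to first components of a common degree, the
    multiplicity of a pair [(a, b)] in either of them is the number of times it
    sends [b x] to [a x], for any path [x] from the source of [a]. *)
Lemma spanval_faithful E F : wf_pairs E -> wf_pairs F ->
  (forall P, perm_eq (act E P) (act F P)) -> spanval s E = spanval s F.
Proof.
move=> wfE wfF EF.
have [M _ EM] := degree_bound E (fun e => kdeg e.1) 0.
have [N MN FN] := degree_bound F (fun e => kdeg e.1) M.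
have {}EM e : e \in E -> leNk (kdeg e.1) N.
  by move=> /EM eM; apply/forallP => x; rewrite (leq_trans (forallP eM x)) ?(forallP MN x).
have [E' [wfE' sE dE]] := refine_left L_row_finite s_ck wfE EM.
have [F' [wfF' sF dF]] := refine_left L_row_finite s_ck wfF FN.
rewrite -sE -sF /spanval; apply: perm_big; apply/allP => e eEF /=.
have [ke we] : kdeg e.1 = N /\ ksrc e.1 = ksrc e.2.
  move: eEF; rewrite mem_cat => /orP[] h.
    by split; [exact: dE|exact/eqP/(allP wfE')].
  by split; [exact: dF|exact/eqP/(allP wfF')].
have [x xe] := infpath_ex L_source_free (kvertices_src e.1).
have [y yx] := prefixed_ex xe.
have [z zx] : exists z, prefixed e.2 x z by apply: prefixed_ex; rewrite -we.
pose P : gpath L := (z, zdeg (kdeg e.2)); pose Q : gpath L := (y, zdeg (kdeg e.1)).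
have ePQ : pair_act e P = Some Q.
  by apply/pair_actP; exists (x, 0); rewrite /= !add0r.
have mult G : (forall f, f \in G -> kdeg f.1 = N) ->
    count_mem e G = count_mem Q (act G P).
  move=> dG; rewrite count_mem_act; apply: eq_in_count => f fG /=.
  apply/eqP/eqP => [->//|fPQ]; apply: act_eq_pair fPQ ePQ _.
  by rewrite ke dG.
rewrite (mult _ dE) (mult _ dF); apply/eqP.
have /permP -> := act_perm L_row_finite s_univ P sE.
have /permP -> := EF P.
by have /permP <- := act_perm L_row_finite s_univ P sF.
Qed.

Lemma act_vertex_pairs P : perm_eq (act (vertex_pairs L) P) [:: P].
Proof.
have vP v : kvertices v -> pair_act (v, v) P = if segment P.1 0 0 == v then Some P else None.
  move=> v0; rewrite /pair_act /= kunshift_vertex//; case: eqP => //= Pv.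
  by rewrite kprepend_vertex// kunshift_vertex// Pv eqxx.
have v0 : segment P.1 0 0 \in fset_set (@kvertices k L).
  rewrite in_fset_set//; apply: mem_set.
  exact: segment_deg.
apply/allP => Q _ /=; rewrite count_mem_act /vertex_pairs count_map addn0.
pose rP := segment P.1 0 0.
have -> : count (preim (fun v => (v, v)) (fun e => pair_act e P == Some Q))
    (fset_set (@kvertices k L)) = count [pred v | (v == rP) && (P == Q)] (fset_set (@kvertices k L)).
  apply: eq_in_count => v; rewrite in_fset_set// => /set_mem /vP /= ->.
  by rewrite -/rP (eq_sym v); case: (rP == v).
case: (P == Q) => /=.
  rewrite (@eq_count _ _ (pred1 rP)); last by move=> v /=; rewrite andbT.
  by rewrite count_uniq_mem ?fset_uniq// v0.
by rewrite (@eq_count _ _ pred0) ?count_pred0// => v /=; rewrite andbF.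
Qed.

(** The coefficients of the operator of [E] are natural numbers, and a unitary
    matrix with such coefficients is a permutation matrix. Conversely, if [E]
    permutes, both products of [E] with its transpose act as the identity, so
    by faithfulness their values are the unit. *)
Lemma cunitary_spanvalP E : wf_pairs E -> cunitary (spanval s E) <-> permutes E.
Proof.
move=> wf.
have unit1 := spanval_vertex_pairs s_ck s_gen L_fin.
have wfV := wf_vertex_pairs L.
have half (F : seq (L * L)) : wf_pairs F ->
    cidentity (cmul (cstar (spanval s F)) (spanval s F)) <->
    (forall P, exists2 Q, act F P = [:: Q] & act (swap_pairs F) Q = [:: P]).
  move=> wfF; split=> [unitF P|FP].
    have := cidentity_uniq unit1 unitF; rewrite -spanval_swap => e.
    have := act_mul L_row_finite s_univ P e.
    rewrite perm_sym => /perm_trans/(_ (act_vertex_pairs P)) /perm_small_eq flatE.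
    have {}flatE := flatE isT.
    have back Q : Q \in act F P -> exists r, act (swap_pairs F) Q = P :: r.
      move=> QF; have : P \in act (swap_pairs F) Q by rewrite mem_act_swap.
      case eQ: (act _ Q) => [|P0 r] // _; exists r; congr (_ :: _).
      suff : P0 \in [:: P] by rewrite inE => /eqP.
      by rewrite -flatE; apply/flatten_mapP; exists Q; rewrite // eQ inE eqxx.
    case FP: (act F P) flatE => [|Q l] // flatE.
    have QF : Q \in act F P by rewrite FP inE eqxx.
    exists Q.
      case: l FP flatE => // Q' l FP /=; have Q'F : Q' \in act F P by rewrite FP !inE eqxx orbT.
      have [r ->] := back _ QF; have [r' /= ->] := back _ Q'F.
      by case: r.
    have [r QP] := back _ QF; move: flatE; rewrite /= QP.
    by case: r {QP}.
  have [G wfG sG] := spanval_mul L_row_finite s_ck (etrans (wf_swap F) wfF) wfF.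
  rewrite -spanval_swap -sG (_ : spanval s G = spanval s (vertex_pairs L))//.
  apply: spanval_faithful => // P.
  rewrite (permPl (act_mul L_row_finite s_univ P sG)).
  rewrite (permPr (act_vertex_pairs P)).
  by have [Q -> /= ->] := FP P.
have wf' : wf_pairs (swap_pairs E) by rewrite wf_swap.
have starE : cmul (spanval s E) (cstar (spanval s E)) =
    cmul (cstar (spanval s (swap_pairs E))) (spanval s (swap_pairs E)).
  by rewrite spanval_swap cstarK.
have size1_act (F : seq (L * L)) P Q : size (act (swap_pairs F) Q) = 1%N ->
    act F P = [:: Q] -> act (swap_pairs F) Q = [:: P].
  move=> h FPQ; have : P \in act (swap_pairs F) Q by rewrite mem_act_swap FPQ inE.
  by case: (act _ _) h => [|P' []] //= _; rewrite inE => /eqP ->.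
split=> [[/(half _ wf) h1 h2] P|pE].
  move: h2; rewrite starE => /(half _ wf') h2.
  by have [Q -> _] := h1 P; have [Q' -> _] := h2 P.
split; last rewrite starE.
  apply/(half _ wf) => P; have [+ _] := pE P.
  case EP: (act E P) => [|Q []] // _; exists Q => //.
  by apply: size1_act EP; case: (pE Q).
apply/(half _ wf') => P; have [_] := pE P.
case EP: (act _ P) => [|Q []] // _; exists Q => //.
by apply: size1_act EP; rewrite swap_pairsK; case: (pE Q).
Qed.

(** The union over all formal sums of value [U]; they all give the same set. *)
Definition bisection_of U : set (path_groupoid L) :=
  [set g | exists E, [/\ wf_pairs E, spanval s E = U & pairs_set E g]].

Lemma bisection_ofE E : wf_pairs E -> bisection_of (spanval s E) = pairs_set E.
Proof.
move=> wf; apply/seteqP; split=> [g [F [_ FE gF]]|g gE]; last by exists E.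
have /perm_mem e := act_perm L_row_finite s_univ (gpd_src g, 0) FE.
by rewrite /pairs_set /= -e.
Qed.

Lemma higman_thompsonP U : higman_thompson s U <->
  exists E, [/\ wf_pairs E, permutes E & U = spanval s E].
Proof.
split.
  move=> [uU [n [al [be [ab UE]]]]].
  pose E := [seq (al i, be i) | i <- enum 'I_n].
  have wf : wf_pairs E by apply/allP => e /mapP[i _ ->] /=; rewrite ab.
  have {}UE : U = spanval s E by rewrite /spanval big_map big_enum /= UE.
  by exists E; split=> //; apply/cunitary_spanvalP; rewrite -?UE.
move=> [E [wf pE ->]]; split; first exact/cunitary_spanvalP.
exists (size E), (fun i => (tnth (in_tuple E) i).1), (fun i => (tnth (in_tuple E) i).2).
split; last by rewrite /spanval big_tnth.
by move=> i; apply/eqP/(allP wf); rewrite mem_tnth.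
Qed.

Lemma pairs_set_mul E F G : wf_pairs E -> wf_pairs F ->
  spanval s G = cmul (spanval s E) (spanval s F) ->
  pairs_set G = bisection_mul (pairs_set E) (pairs_set F).
Proof.
move=> wfE wfF sG.
have actG P Q := perm_mem (act_mul L_row_finite s_univ P sG) Q.
apply/seteqP; split=> t.
  rewrite /pairs_set /= actG => /flatten_mapP[[y n] yF tE].
  have [h hF [hr hd hs]] := act_pairs_set wfF yF.
  have [g gE [gr gd gs]] := act_pairs_set wfE tE.
  exists g, h; split=> //; split; first by rewrite gs hr.
  rewrite gr gd hd hs subr0 subrK /gpd_rng /gpd_deg /gpd_src.
  by case: (gpd_val t) => [[]].
move=> [g [h [gE hF [gh tE]]]].
have [tr td ts] : [/\ gpd_rng t = gpd_rng g, gpd_deg t = gpd_deg g + gpd_deg h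
    & gpd_src t = gpd_src h] by rewrite /gpd_rng /gpd_deg /gpd_src tE.
rewrite /pairs_set /= actG tr td ts; apply/flatten_mapP.
exists (gpd_rng h, gpd_deg h) => //.
by rewrite -gh; exact: pairs_set_act.
Qed.

Lemma permutes_pairs_set_inj E F : wf_pairs E -> wf_pairs F ->
  permutes E -> permutes F -> pairs_set E = pairs_set F -> spanval s E = spanval s F.
Proof.
move=> wfE wfF pE pF EF; apply: spanval_faithful => // -[y m].
have [[x n] xE] := size1_mem (proj1 (pE (y, m))).
have xF : (x, n) \in act F (y, m).
  have [g + [gr gd gs]] := act_pairs_set wfE xE; rewrite EF => gF.
  by have := pairs_set_act m gF; rewrite gr gd gs subrK.
move: (proj1 (pE (y, m))) (proj1 (pF (y, m))) xE xF.
case: (act E _) => [|Q [|]] //= _; case: (act F _) => [|Q' [|]] //= _.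
by rewrite !inE => /eqP <- /eqP <-.
Qed.

(** [W] is a finite union of cylinders. Refined to first components of a common
    degree and without repetitions, they are disjoint, so that each element of
    [W] counts once in the action. *)
Lemma full_bisection_pairs (W : set (path_groupoid L)) : full_bisections W ->
  exists E, [/\ wf_pairs E, permutes E & pairs_set E = W].
Proof.
move=> [[W_rng W_src] [full_src full_rng] Wc Wo].
have [E0 wf0 E0W] := compact_open_pairs Wc Wo.
have [N _ EN] := degree_bound E0 (fun e => kdeg e.1) 0.
have [E1 [wf1 sE1 dE1]] := refine_left L_row_finite s_ck wf0 EN.
have E1W : pairs_set E1 = W by rewrite -E0W -!bisection_ofE// sE1.
pose E := undup E1.
have actE P : act E P =i act E1 P.
  by move=> Q; apply/mem_act/mem_act => -[e]; rewrite ?mem_undup => eE eQ; exists e; rewrite ?mem_undup.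
have EW : pairs_set E = W by rewrite -E1W; apply/seteqP; split=> g; rewrite /pairs_set /= actE.
have wf : wf_pairs E by apply/allP => e; rewrite mem_undup; exact: (allP wf1).
have uact P : uniq (act E P).
  have dE e : e \in E -> kdeg e.1 = N by rewrite mem_undup; exact: dE1.
  rewrite /act; elim: (E) dE (undup_uniq E1 : uniq E) => //= e F IH dF /andP[eF uF].
  have {}IH := IH (fun f fF => dF f (mem_behead (fF : f \in behead (e :: F)))) uF.
  case eP: (pair_act e P) => [Q|] //=; rewrite IH andbT; apply: contra eF.
  move=> /mem_act[f fF fP].
  by rewrite (act_eq_pair eP fP) // !dF ?inE ?eqxx ?fF ?orbT.
exists E; split=> // -[y m]; split.
  have [g Wg gy] : exists2 g, W g & gpd_src g = y.
    by have : [set: infpath L] y by []; rewrite -full_src => -[g Wg <-]; exists g.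
  have gact : (gpd_rng g, gpd_deg g + m) \in act E (y, m).
    by rewrite -gy; apply: pairs_set_act; rewrite EW.
  apply/eqP; rewrite (@perm_size _ _ [:: (gpd_rng g, gpd_deg g + m)])//.
  apply: uniq_perm => // -[x n]; rewrite inE; apply/idP/eqP => [xn|-> //].
  have [h hE [hr hd hs]] := act_pairs_set wf xn.
  have -> : g = h by apply: W_src;
    [exact: mem_set|by apply: mem_set; rewrite -EW|by rewrite gy hs].
  by rewrite hr hd subrK.
have [g Wg gx] : exists2 g, W g & gpd_rng g = y.
  by have : [set: infpath L] y by []; rewrite -full_rng => -[g Wg <-]; exists g.
have gact : (gpd_src g, m - gpd_deg g) \in act (swap_pairs E) (y, m).
  rewrite mem_act_swap -gx -[X in (_, X)](subrKC (gpd_deg g) m).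
  by apply: pairs_set_act; rewrite EW.
have uswap Q : uniq (act (swap_pairs E) Q).
  by apply: count_mem_uniq => P; rewrite count_mem_act_swap count_uniq_mem// mem_act_swap.
apply/eqP; rewrite (@perm_size _ _ [:: (gpd_src g, m - gpd_deg g)])//.
apply: uniq_perm => // -[x n]; rewrite inE; apply/idP/eqP => [|-> //].
rewrite mem_act_swap => /(act_pairs_set wf)[h hE [hr hd hs]].
have -> : g = h by apply: W_rng;
  [exact: mem_set|by apply: mem_set; rewrite -EW|by rewrite gx hr].
by rewrite hs hd subKr.
Qed.

End HigmanThompson.

Lemma is_group_transport T1 (S1 : set T1) (op1 : T1 -> T1 -> T1)
    T2 (S2 : set T2) (op2 : T2 -> T2 -> T2) (f : T1 -> T2) :
  is_group S1 op1 -> set_bij S1 S2 f ->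
  (forall x y, S1 x -> S1 y -> f (op1 x y) = op2 (f x) (f y)) -> is_group S2 op2.
Proof.
move=> [op1S op1A [e [eS e1 inv1]]] [fS _ fsurj] fM.
split.
- move=> _ _ /fsurj[x Sx <-] /fsurj[y Sy <-]; rewrite -fM//.
  by apply: fS; exact: op1S.
- move=> _ _ _ /fsurj[x Sx <-] /fsurj[y Sy <-] /fsurj[z Sz <-].
  by rewrite -!fM ?op1A//; exact: op1S.
- exists (f e); split; first exact: fS.
    by move=> _ /fsurj[x Sx <-]; rewrite -!fM//; have [-> ->] := e1 x Sx.
  move=> _ /fsurj[x Sx <-]; have [y Sy [xy yx]] := inv1 x Sx.
  by exists (f y); [exact: fS|rewrite -!fM// xy yx].
Qed.

Theorem proposition3p6 (R : realType) (k : nat) (k_gt0 : (0 < k)%N)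
    (L : kgraph k) (L_row_finite : row_finite L) (L_source_free : source_free L)
    (L_finite_vertices : finite_set (@kvertices k L))
    (O_L : cstarAlgebra R) (s : L -> O_L) (O_L_universal : universal_ck_family s) :
  group_isomorphic (higman_thompson s) (@cmul R O_L)
    (@full_bisections k L) (@bisection_mul k L).
Proof.
have [s_ck s_gen _] := O_L_universal.
have HTP := higman_thompsonP L_row_finite L_source_free L_finite_vertices O_L_universal.
have bisE := bisection_ofE L_row_finite O_L_universal.
have unit1 := spanval_vertex_pairs s_ck s_gen L_finite_vertices.
set e := spanval s (vertex_pairs L) in unit1.
have es : cstar e = e.
  have [_ e1] := unit1 (cstar e).
  have : cstar (cmul (cstar e) e) = cmul (cstar e) e by rewrite cstarM cstarK.
  by rewrite e1 cstarK.
have HT_group : is_group (higman_thompson s) (@cmul R O_L).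
  split; last 2 first.
  - by move=> *; exact: cmulA.
  - exists e; split; last 2 first.
    + by move=> x _; exact: unit1.
    + move=> x [[xx1 xx2] xE]; exists (cstar x); last first.
        by rewrite (cidentity_uniq xx1 unit1) (cidentity_uniq xx2 unit1).
      have /HTP[E [wf pE ->]] : higman_thompson s x by [].
      apply/HTP; exists (swap_pairs E); split; rewrite ?wf_swap ?spanval_swap//.
      by move=> P; rewrite swap_pairsK; case: (pE P).
    apply/HTP; exists (vertex_pairs L); split=> //; first exact: wf_vertex_pairs.
    apply/(cunitary_spanvalP L_row_finite L_source_free L_finite_vertices O_L_universal).
      exact: wf_vertex_pairs.
    by rewrite /cunitary -/e es; have [-> _] := unit1 e.
  move=> x y hx hy; have [[xx1 xx2] _] := hx; have [[yy1 yy2] _] := hy.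
  have [E [wfE _ xE]] := (HTP x).1 hx; have [F [wfF _ yF]] := (HTP y).1 hy.
  have [G wfG sG] := spanval_mul L_row_finite s_ck wfE wfF.
  rewrite xE yF -sG; apply/HTP; exists G; split=> //.
  apply/(cunitary_spanvalP L_row_finite L_source_free L_finite_vertices O_L_universal wfG).
  rewrite sG -xE -yF; split; rewrite cstarM.
    by rewrite -cmulA [X in cmul _ X]cmulA; have [-> _] := xx1 y.
  by rewrite -cmulA [X in cmul _ X]cmulA; have [-> _] := yy2 (cstar x).
have f_bij : set_bij (higman_thompson s) (@full_bisections k L) (bisection_of s).
  split.
  - move=> _ /HTP[E [wf pE ->]]; rewrite bisE//.
    exact: permutes_full_bisection.
  - move=> x y; rewrite !inE => /HTP[E [wfE pE ->]] /HTP[F [wfF pF ->]].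
    rewrite !bisE//; exact: permutes_pairs_set_inj.
  - move=> W /(full_bisection_pairs L_row_finite O_L_universal)[E [wf pE <-]].
    by exists (spanval s E); [apply/HTP; exists E|rewrite bisE].
have f_mul x y : higman_thompson s x -> higman_thompson s y ->
    bisection_of s (cmul x y) = bisection_mul (bisection_of s x) (bisection_of s y).
  move=> /HTP[E [wfE _ ->]] /HTP[F [wfF _ ->]].
  have [G wfG sG] := spanval_mul L_row_finite s_ck wfE wfF.
  rewrite -sG !bisE//; exact: pairs_set_mul sG.
split=> //; first exact: is_group_transport HT_group f_bij f_mul.
by exists (bisection_of s).
Qed.
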